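(* The set of all varieties of semigroups with completely regular power is definable. For every natural number $k$, the set of all varieties of semigroups with completely regular $k^{\text{th}}$ power is definable.
   Context: $\mathbf{SEM}$ denotes the lattice of all semigroup varieties, ordered by inclusion, with join $\vee$ and meet $\wedge$. A subset $A$ of a lattice $\langle L;\vee,\wedge\rangle$ is called definable in $L$ if there is a first-order formula $\Phi(x)$ with one free variable $x$ (and no parameters) in the language of the lattice operations $\vee$ and $\wedge$ such that, for every $a\in L$, the sentence $\Phi(a)$ is true in $L$ if and only if $a\in A$. A set of semigroup varieties is called definable if it is definable in $\mathbf{SEM}$. Natural numbers start from $1$. For a semigroup $S$, $S^n$ denotes the subsemigroup of all products of $n$ elements of $S$. A semigroup is completely regular if it is a union of groups. A semigroup variety $\mathcal V$ is called a variety of semigroups with completely regular power if for every $S\in\mathcal V$ there is a natural number $n$ such that the semigroup $S^n$ is completely regular. A variety $\mathcal V$ is called a variety of semigroups with completely regular $k^{\text{th}}$ power if $S^k$ is completely regular for every $S\in\mathcal V$ and $k$ is the least number with this property. *)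

(* Defs.v *)
From HB Require Import structures.
From mathcomp Require Import all_boot all_order.
From mathcomp Require Import boolp classical_sets.

Set Implicit Arguments.
Unset Strict Implicit.
Unset Printing Implicit Defensive.

Import Order.TTheory.

Local Open Scope classical_set_scope.

(* Not semigroupType: collections of semigroupType's live in too large a
   universe to carry a choiceType, hence a latticeType, structure. *)
Record semigroup := Semigroup {
  carrier :> Type;
  smul : carrier -> carrier -> carrier;
  smulA : associative smul;
  semigroup_nonempty : inhabited carrier
}.

Declare Scope semigroup_scope.
Delimit Scope semigroup_scope with sg.
Notation "x * y" := (smul x y) : semigroup_scope.

Section SemigroupSubsets.
Variable S : semigroup.

Definition sprod (x : S) (s : seq S) : S := foldl (fun y z => (y * z)%sg) x s.

Definition spower (n : nat) : set S :=
  [set z | exists (x : S) (s : seq S), (size s).+1 = n /\ z = sprod x s].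

Definition is_subgroup (G : set S) : Prop :=
  (forall x y, G x -> G y -> G (x * y)%sg) /\
  exists e, [/\ G e,
    (forall x, G x -> (e * x)%sg = x /\ (x * e)%sg = x) &
    (forall x, G x -> exists y, [/\ G y, (x * y)%sg = e & (y * x)%sg = e])].

Definition completely_regular (A : set S) : Prop :=
  exists F : set (set S),
    (forall G, F G -> is_subgroup G) /\ A = \bigcup_(G in F) G.

End SemigroupSubsets.

(* The nonempty word a_0 a_1 ... a_n is the pair (a_0, [:: a_1; ...; a_n]). *)
Definition word : Type := (nat * seq nat)%type.

Definition word_val (S : semigroup) (f : nat -> S) (w : word) : S :=
  sprod (f w.1) (map f w.2).

Definition identity : Type := (word * word)%type.

Definition satisfies (S : semigroup) (i : identity) : Prop :=
  forall f : nat -> S, word_val f i.1 = word_val f i.2.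

Definition models (Sigma : set identity) : set semigroup :=
  [set S : semigroup | forall i, Sigma i -> satisfies S i].

Record SEM := Variety {
  members :> set semigroup;
  membersP : exists Sigma : set identity, members = models Sigma
}.

Definition identities_of (V : set semigroup) : set identity :=
  [set i | forall S, V S -> satisfies S i].

Definition models_variety (Sigma : set identity) : SEM :=
  @Variety (models Sigma) (ex_intro _ Sigma erefl).

Lemma SEM_eq (V W : SEM) : members V = members W -> V = W.
Proof.
case: V W => V VP [W WP] /= VW; case: _ / VW WP => WP.
by rewrite (Prop_irrelevance VP WP).
Qed.

Lemma models_identities_of (V : SEM) :
  models (identities_of V) = V :> set semigroup.
Proof.
have [Sigma ->] := membersP V; apply/seteqP; split=> S SP i iP.
  by apply: SP => T; apply.
by apply: iP.
Qed.

HB.instance Definition _ := gen_eqMixin SEM.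
HB.instance Definition _ := gen_choiceMixin SEM.

Definition SEM_le (V W : SEM) : bool := `[< V `<=` W >].

(* The varieties given by Id V `|` Id W and by Id V `&` Id W, where Id is the
   equational theory; they are the greatest lower bound and the least upper
   bound for inclusion. *)
Definition SEM_meet (V W : SEM) : SEM :=
  models_variety (identities_of V `|` identities_of W).

Definition SEM_join (V W : SEM) : SEM :=
  models_variety (identities_of V `&` identities_of W).

Lemma SEM_le_refl : reflexive SEM_le.
Proof. by move=> V; apply/asboolP. Qed.

Lemma SEM_le_anti : antisymmetric SEM_le.
Proof.
by move=> V W /andP[/asboolP VW /asboolP WV]; apply/SEM_eq/seteqP.
Qed.

Lemma SEM_le_trans : transitive SEM_le.
Proof.
by move=> W V U /asboolP VW /asboolP WU; apply/asboolP/(subset_trans VW).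
Qed.

Fact SEM_display : Order.disp_t. Proof. exact: Order.Disp tt tt. Qed.

HB.instance Definition _ :=
  Order.Le_isPOrder.Build SEM_display SEM
    SEM_le_refl SEM_le_anti SEM_le_trans.

Lemma SEM_leE (V W : SEM) : (V <= W)%O = `[< V `<=` W >].
Proof. by []. Qed.

Lemma SEM_meetE (V W : SEM) :
  SEM_meet V W = V `&` W :> set semigroup.
Proof.
rewrite -[in RHS](models_identities_of V) -[in RHS](models_identities_of W).
apply/seteqP; split=> [S SP|S [SV SW] i [/SV|/SW] //].
by split=> i iP; apply: SP; [left|right].
Qed.

Lemma SEM_meetP (U V W : SEM) :
  (U <= SEM_meet V W)%O = (U <= V)%O && (U <= W)%O.
Proof.
rewrite !SEM_leE SEM_meetE; apply/asboolP/andP => [|[]].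
  by rewrite subsetI => -[UV UW]; split; apply/asboolP.
by move=> /asboolP UV /asboolP UW; rewrite subsetI.
Qed.

Lemma SEM_joinP (V W U : SEM) :
  (SEM_join V W <= U)%O = (V <= U)%O && (W <= U)%O.
Proof.
rewrite !SEM_leE; apply/asboolP/andP => [VWU|[/asboolP VU /asboolP WU]].
  by split; apply/asboolP => S SP; apply: VWU => i [iV iW]; [apply: iV|apply: iW].
rewrite -[X in _ `<=` X]models_identities_of => S SP i iU.
by apply: SP; split=> T TP; apply: iU; [apply: VU|apply: WU].
Qed.

HB.instance Definition _ :=
  @Order.POrder_MeetJoin_isLattice.Build SEM_display SEM
    SEM_meet SEM_join SEM_meetP SEM_joinP.

(* Terms and formulas with variables in 'I_n; under a quantifier, variable
   ord0 is the bound one and the others are shifted by lift ord0. *)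
Inductive term (n : nat) : Type :=
| TVar of 'I_n
| TJoin of term n & term n
| TMeet of term n & term n.

Inductive formula : nat -> Type :=
| FEq n of term n & term n : formula n
| FNot n of formula n : formula n
| FAnd n of formula n & formula n : formula n
| FOr n of formula n & formula n : formula n
| FImp n of formula n & formula n : formula n
| FAll n of formula n.+1 : formula n
| FEx n of formula n.+1 : formula n.

Section Semantics.
Variables (d : Order.disp_t) (L : latticeType d).

Fixpoint term_val n (e : 'I_n -> L) (t : term n) : L :=
  match t with
  | TVar i => e i
  | TJoin s t => (term_val e s `|` term_val e t)%O
  | TMeet s t => (term_val e s `&` term_val e t)%O
  end.

Definition env_cons n (a : L) (e : 'I_n -> L) (i : 'I_n.+1) : L :=
  if unlift ord0 i is Some j then e j else a.

Fixpoint holds n (phi : formula n) : ('I_n -> L) -> Prop :=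
  match phi with
  | FEq _ s t => fun e => term_val e s = term_val e t
  | FNot _ p => fun e => ~ holds p e
  | FAnd _ p q => fun e => holds p e /\ holds q e
  | FOr _ p q => fun e => holds p e \/ holds q e
  | FImp _ p q => fun e => holds p e -> holds q e
  | FAll _ p => fun e => forall a, holds p (env_cons a e)
  | FEx _ p => fun e => exists a, holds p (env_cons a e)
  end.

Definition definable (A : set L) : Prop :=
  exists Phi : formula 1, forall a : L, holds Phi (fun=> a) <-> A a.

End Semantics.

Definition has_cr_power (V : SEM) : Prop :=
  forall S : semigroup, members V S ->
    exists n : nat, (0 < n)%N /\ completely_regular (@spower S n).

Definition all_powers_cr (k : nat) (V : SEM) : Prop :=
  forall S : semigroup, members V S -> completely_regular (@spower S k).

Definition has_cr_kth_power (k : nat) (V : SEM) : Prop :=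
  all_powers_cr k V /\
  forall j : nat, (0 < j)%N -> all_powers_cr j V -> (k <= j)%N.

(* Main.v *)
Require Import Defs.
From mathcomp Require Import all_boot all_order.
From mathcomp Require Import boolp classical_sets.

Set Implicit Arguments.
Unset Strict Implicit.
Unset Printing Implicit Defensive.

Import Order.TTheory.
Local Open Scope classical_set_scope.

(** The [k]-th powers of all the semigroups in a variety [V] are completely regular if
    and only if [V] contains none of three varieties, which are definable up to
    duality. The least such [k] is then expressed by finitely many of these conditions.

    The obstructions. Let [P3] be the semigroup [{e, a, 0}] where [e] is a left
    identity of [{e, a}] and the other products are zero, and let [Csq (k+1)] be the
    variety of commutative semigroups satisfying [x^2 = 0] and [x_1 ... x_(k+1) = 0].
    In [P3], in its dual and in the free objects of [Csq (k+1)], some product of [k]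
    elements lies in no subgroup. Conversely, suppose that [V] contains none of them.
    Then [V] satisfies an identity [u = v] where [u] is a product of at most [k]
    distinct letters and [v] is not a permutation of [u]. In a nil semigroup such an
    identity makes all the products of [k] elements zero ([nil_ideal_power]): if [v]
    is longer than [u], these products have factorizations of any length, which can be
    rearranged so as to contain arbitrary powers of a single element. In general, a
    product [x] of [k] elements has an idempotent factor, say [x = b e c]; an identity
    failing in [P3] shows that [e c] lies in a subgroup, and an identity failing in
    its dual that [x] does ([product_in_subgroup]). For completely regular powers with
    an exponent depending on the semigroup, the role of [Csq (k+1)] is played by the
    variety [Csq_oo] of commutative semigroups satisfying [x^2 = 0] ([all_powers_crE],
    [has_cr_powerE]).

    The definitions. Every nontrivial variety contains all semilattices, all left zero
    semigroups, all right zero semigroups, all semigroups with zero multiplication, or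
    all abelian groups of some prime exponent ([atoms_below]), which gives the atoms
    of the lattice. A variety containing infinitely many of the group atoms contains
    the variety [COM] of all commutative semigroups, which is thus the least variety
    containing all the atoms but two. Below [COM], zero multiplication and
    semilattices are the only atoms [A] and [B] such that every variety containing [B]
    but not [A] is the join of [B] with a variety not containing [B]: commutative
    unions of groups are joins of groups and semilattices, and there are
    counterexamples for all other pairs ([splits_offE]). The commutative nil varieties
    are those below [COM] that have no atom other than zero multiplication. Among
    those whose subvarieties form a chain, there is a greatest one with enough
    subvarieties, and this is [Csq_oo] ([Csq_oo_unique]). Its subvarieties are itself
    and the varieties [Csq k], which are found by counting from below ([Csq_succ]).
    Finally, [V] contains [P3] or its dual if and only if it has a noncommutative
    subvariety without atoms other than semilattices and zero multiplication, and
    without [Csq 3] ([witnessP]). *)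

(** * Words and their values *)

Definition letters (w : word) : seq nat := w.1 :: w.2.

Definition word_cat (u v : word) : word := (u.1, u.2 ++ letters v).

Section Products.
Variable S : semigroup.
Implicit Types (x y z l : S) (s t : seq S).
Local Open Scope semigroup_scope.

(** The power [x^(n+1)]: there is no empty product. *)
Definition pw x n : S := sprod x (nseq n x).

Lemma sprod_cat l s t : sprod l (s ++ t) = sprod (sprod l s) t.
Proof. exact: foldl_cat. Qed.

Lemma sprod_mul x y s : sprod (x * y) s = x * sprod y s.
Proof. by elim: s y => //= z s IH y; rewrite -smulA IH. Qed.

Lemma sprod_cons l x s : sprod l (x :: s) = l * sprod x s.
Proof. exact: sprod_mul. Qed.

Lemma word_valE (f : nat -> S) w l :
  sprod l (map f (letters w)) = l * word_val f w.
Proof. exact: sprod_cons. Qed.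

Lemma eq_word_val (f g : nat -> S) w :
  {in letters w, f =1 g} -> word_val f w = word_val g w.
Proof.
move=> fg; rewrite /word_val fg ?mem_head //; congr (sprod _ _).
by apply/eq_in_map => a aw; apply: fg; rewrite inE aw orbT.
Qed.

Lemma word_val_map (f : nat -> S) h w :
  word_val f (h w.1, map h w.2) = word_val (f \o h) w.
Proof. by rewrite /word_val -map_comp. Qed.

Lemma pw0 x : pw x 0 = x. Proof. by []. Qed.

Lemma pwSl x n : pw x n.+1 = x * pw x n.
Proof. exact: sprod_cons. Qed.

Lemma pwD x m n : pw x m * pw x n = pw x (m + n).+1.
Proof. by elim: m => [|m IH]; rewrite ?pw0 ?addSn pwSl // -smulA IH -pwSl. Qed.

Lemma pwSr x n : pw x n.+1 = pw x n * x.
Proof. by rewrite -[in RHS](pw0 x) pw0 -[X in _ = _ * X]pw0 pwD addn0. Qed.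

Lemma pw_pw x m n : pw (pw x m) n = pw x (m.+1 * n.+1).-1.
Proof.
elim: n => [|n IH]; first by rewrite muln1.
by rewrite pwSl IH pwD -addnS prednK ?muln_gt0 // (mulnS m.+1 n.+1) addSn.
Qed.

Lemma word_val_nseq (f : nat -> S) a n : word_val f (a, nseq n a) = pw (f a) n.
Proof. by rewrite /word_val map_nseq. Qed.

Lemma word_val_const x w : word_val (fun=> x) w = pw x (size w.2).
Proof. by rewrite /word_val /pw; congr (sprod _ _); elim: w.2 => //= a s ->. Qed.

(** Two words over two semigroups can be evaluated in parallel along any
    multiplicative relation: this is how a failing identity of a small semigroup
    is turned into an equality in an arbitrary one. *)
Lemma word_val_rel (T : semigroup) (R : S -> T -> Prop) f g w :
    (forall (x y : S) (x' y' : T), R x x' -> R y y' -> R (x * y) (x' * y')) ->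
    (forall a, R (f a) (g a)) ->
  R (word_val f w) (word_val g w).
Proof.
move=> RM Rfg; case: w => a s; rewrite /word_val /=.
by elim: s (f a) (g a) (Rfg a) => //= b s IH x x' Rx; apply/IH/RM.
Qed.

Lemma hom_word_val (T : semigroup) (h : S -> T) f w :
  {morph h : x y / x * y} -> h (word_val f w) = word_val (h \o f) w.
Proof.
move=> hM.
by apply: (@word_val_rel T (fun x u => h x = u)) => // x y _ _ <- <-.
Qed.

End Products.

Arguments pw {S} x n.

Lemma letters_cat u v : letters (word_cat u v) = letters u ++ letters v.
Proof. by []. Qed.

Definition free_semigroup : semigroup.
Proof.
apply: (@Defs.Semigroup word word_cat); last exact: (inhabits (0, [::])).
by move=> u v w; rewrite /word_cat /letters /= -catA.
Defined.

Definition subst (g : nat -> word) (w : word) : word :=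
  @word_val free_semigroup g w.

Lemma letters_subst g w :
  letters (subst g w) = flatten [seq letters (g a) | a <- letters w].
Proof.
case: w => a s; rewrite /subst /word_val /=.
elim: s (g a) => [|b s IH] u /=; first by rewrite cats0.
by rewrite IH /= -catA.
Qed.

Lemma word_val_letter w :
  @word_val free_semigroup (fun a => (a, [::])) w = w.
Proof.
case: w => a s; rewrite /word_val /=.
have val t : @sprod free_semigroup (a, t) [seq (b, [::]) | b <- s] = (a, t ++ s).
  elim: s t => [|b s IH] t; first by rewrite /= cats0.
  by rewrite -[LHS]/(@sprod free_semigroup (a, t ++ [:: b]) _) IH -catA.
exact: val.
Qed.

(** * Varieties *)

Section Varieties.
Implicit Types V W X : SEM.

Lemma SEM_leP V W : (V <= W)%O <-> forall S, members V S -> members W S.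
Proof. by rewrite SEM_leE; split=> [/asboolP|?]; last apply/asboolP. Qed.

Lemma membersE V S : members V S <-> forall i, identities_of V i -> satisfies S i.
Proof. by rewrite -{1}(models_identities_of V). Qed.

Lemma not_le_members X V : ~ (X <= V)%O ->
  exists S i, [/\ members X S, identities_of V i & ~ satisfies S i].
Proof.
move=> nXV; apply: contrapT => nex; apply: nXV; apply/SEM_leP => S XS.
apply/membersE => i Vi; apply: contrapT => nSi; apply: nex.
by exists S, i.
Qed.

Lemma not_le_models Sigma V : ~ (models_variety Sigma <= V)%O ->
  exists2 i, identities_of V i & ~ Sigma i.
Proof.
by move=> /not_le_members[S [i [SS Vi nSi]]]; exists i => // /SS.
Qed.

Definition var (S : semigroup) : SEM :=
  models_variety (identities_of [set S]).

Lemma var_self S : members (var S) S.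
Proof. by move=> i; apply. Qed.

Lemma var_le S V : (var S <= V)%O <-> members V S.
Proof.
split=> [/SEM_leP|VS]; first by apply; apply: var_self.
by apply/SEM_leP => T TS; apply/membersE => i Vi; apply: TS => _ ->; apply: Vi.
Qed.

Lemma not_var_le S V : ~ (var S <= V)%O ->
  exists i f, identities_of V i /\ @word_val S f i.1 <> word_val f i.2.
Proof.
move=> /var_le/membersE/existsNP[i /not_implyP[Vi /existsNP[f fi]]].
by exists i, f.
Qed.

Lemma identities_ofC V i : identities_of V i -> identities_of V (i.2, i.1).
Proof. by move=> Vi S VS f; rewrite Vi. Qed.

Lemma members_sub V W S : (V <= W)%O -> members V S -> members W S.
Proof. by move/SEM_leP; apply. Qed.

Lemma members_meet V W S : members (V `&` W)%O S <-> members V S /\ members W S.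
Proof. by rewrite -[(V `&` W)%O]/(SEM_meet V W) SEM_meetE. Qed.

Lemma members_join V W S : members (V `|` W)%O S <->
  forall i, identities_of V i -> identities_of W i -> satisfies S i.
Proof.
rewrite -[(V `|` W)%O]/(SEM_join V W).
by split=> [VW i Vi Wi|VW i []]; [apply: VW|apply: VW].
Qed.

End Varieties.

(** * Identities forcing nil semigroups to be nilpotent *)

Section Powers.
Variable S : semigroup.
Implicit Types (x y z l : S) (s t : seq S).
Local Open Scope semigroup_scope.

Lemma spowerP n z :
  spower n.+1 z <-> exists x s, size s = n /\ z = sprod x s.
Proof.
split=> [[x [s [[sn] ->]]]|[x [s [sn ->]]]]; exists x, s; first by [].
by rewrite sn.
Qed.

Lemma spower_sprod x s : spower (size s).+1 (sprod x s).
Proof. by exists x, s. Qed.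

Lemma spower_word_val (f : nat -> S) w : spower (size (letters w)) (word_val f w).
Proof. by exists (f w.1), (map f w.2); rewrite size_map. Qed.

Lemma spowerM m n x y : spower m x -> spower n y -> spower (m + n) (x * y).
Proof.
move=> [a [s [<- ->]]] [b [t [<- ->]]]; exists a, (s ++ b :: t).
by rewrite size_cat addSn sprod_cat sprod_cons.
Qed.

Lemma spower_split m n x : (0 < m)%N -> (0 < n)%N -> spower (m + n) x ->
  exists y z, [/\ spower m y, spower n z & x = y * z].
Proof.
case: m n => [//|m] [//|n] _ _ [a [s []]]; rewrite addSn => -[ss ->].
have sz : size (drop m s) = n.+1 by rewrite size_drop ss addKn.
case ds: (drop m s) sz => [//|b t] /= [tn].
exists (sprod a (take m s)), (sprod b t); split.
- have {1}<- : size (take m s) = m by rewrite size_takel // ss leq_addr.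
  exact: spower_sprod.
- by rewrite -tn; apply: spower_sprod.
- by rewrite -sprod_cons -ds -sprod_cat cat_take_drop.
Qed.

Lemma spower_le m n x : (0 < m <= n)%N -> spower n x -> spower m x.
Proof.
case/andP=> m0 /subnK <-; elim: (n - m)%N => // k IH kx; apply: IH.
move: kx; rewrite addSn; case: m m0 => // m _; rewrite addnS.
move=> /spowerP[a [[|b s] []]] // [sk] ->; apply/spowerP.
by exists (a * b), s.
Qed.

(** If the powers of [S] are eventually constant, this is their common value, an ideal
    in which every element is a product of any number of elements of the ideal. *)
Definition core x := forall n, spower n.+1 x.

Lemma core_mulr x y : core x -> core (x * y).
Proof.
move=> cx n; apply: (@spower_le _ n.+2); first by rewrite ltnS leqnSn.
by rewrite -addn1; apply: spowerM (cx n) _; exists y, [::].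
Qed.

Lemma core_mull x y : core y -> core (x * y).
Proof.
move=> cy n; apply: (@spower_le _ n.+2); first by rewrite ltnS leqnSn.
by rewrite -add1n; apply: spowerM (cy n); exists x, [::].
Qed.

Lemma core_sprod x s : core x -> core (sprod x s).
Proof. by elim: s x => //= y s IH x cx; apply/IH/core_mulr. Qed.

(** Absorbs a possibly empty product into the core element following it. *)
Lemma core_absorb s c : core c ->
  exists2 c', core c' & forall l, sprod l s * c = l * c'.
Proof.
move=> cc; case: s => [|x s]; first by exists c.
exists (sprod x s * c); first exact: core_mull.
by move=> l; rewrite sprod_cons smulA.
Qed.

Variable k : nat.
Hypothesis k_gt0 : (0 < k)%N.
Variable w : word.
Hypothesis w_size : (k < size (letters w))%N.
Hypothesis w_letters : all (fun a => (a < k)%N) (letters w).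
Hypothesis w_eq : satisfies S ((0, iota 1 k.-1), w).

Let letters_iota : letters (0, iota 1 k.-1) = iota 0 k.
Proof. by rewrite -[in RHS](prednK k_gt0). Qed.

Lemma w_sprod l s : size s = k -> sprod l s = sprod l (map (nth l s) (letters w)).
Proof.
move=> sk; rewrite word_valE -w_eq -word_valE letters_iota -sk.
by rewrite [map _ _]mkseq_nth.
Qed.

(** Where an identity equates a product of [k] elements with a longer one, the powers
    of [S] do not decrease from the [k]-th on. *)
Lemma core_power x : spower k x -> core x.
Proof.
have step0 z : spower k z -> spower k.+1 z.
  move=> [y [s [sk ->]]].
  have -> : sprod y s = word_val (nth y (y :: s)) (0, iota 1 k.-1).
    rewrite /word_val /=; congr (sprod _ _).
    rewrite (iotaDl 1 0) -map_comp /= -[s in LHS](mkseq_nth y) /mkseq.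
    by rewrite -sk.
  by rewrite w_eq; apply: spower_le (spower_word_val _ _); rewrite w_size.
have step r z : spower (k + r) z -> spower (k + r).+1 z.
  case: r => [|r]; first by rewrite addn0; apply: step0.
  move=> /spower_split[//|//|y [y' [/step0 ky ry' ->]]].
  exact: spowerM ky ry'.
move=> kx n.
have kr r : spower (k + r) x.
  by elim: r => [|r IH]; rewrite ?addn0 // addnS; apply: step.
by apply: spower_le (kr n.+1); rewrite leq_addl.
Qed.

Lemma core_splitr n c : core c ->
  exists s c', [/\ size s = n, core c' & forall l, l * c = sprod l s * c'].
Proof.
case: n => [|n] cc; first by exists [::], c; split.
have /spower_split[//|//|y [c' [/spowerP[x [s [sn ->]]] kc' ->]]] :
    spower (n.+1 + k) c by rewrite -(prednK k_gt0) addnS.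
exists (x :: s), c'; split; [by rewrite /= sn|exact: core_power|].
by move=> l; rewrite sprod_cons smulA.
Qed.

Lemma core_splitl n c : core c ->
  exists s c', [/\ size s = n, core c' & c = sprod c' s].
Proof.
case: n => [|n] cc; first by exists [::], c; split.
have /spower_split[//|//|c' [y [kc' /spowerP[x [s [sn ->]]] ->]]] :
    spower (k + n.+1) c by rewrite -(prednK k_gt0) addSn.
exists (x :: s), c'; split; [by rewrite /= sn|exact: core_power|].
by rewrite sprod_cons.
Qed.

Lemma core_split2 c : core c -> exists b d, [/\ core b, core d & c = b * d].
Proof.
move=> cc; have /spower_split[//|//|b [d [kb kd ->]]] : spower (k + k) c.
  by rewrite -(prednK k_gt0) addSn.
by exists b, d; split=> //; apply: core_power.
Qed.


(** The sequence [w] first departs from [0, 1, 2, ...] at the place [p], where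
    it has [q] instead of [p]. *)
Variables (p q : nat) (w' : seq nat).
Hypothesis w_prefix : letters w = iota 0 p ++ q :: w'.

Let w_sprod_prefix l s : size s = k -> (p <= k)%N ->
  sprod l s = sprod (sprod l (take p s)) (nth l s q :: map (nth l s) w').
Proof.
move=> sk pk; rewrite w_sprod // w_prefix map_cat sprod_cat /=.
by rewrite map_nth_iota0 // sk.
Qed.

Variable I : S -> Prop.
Hypothesis I_mull : forall x y, I y -> I (x * y).
Hypothesis I_mulr : forall x y, I x -> I (x * y).
Hypothesis I_nil : forall x, exists n, I (pw x n).

(** If [q < p], the identity makes a product grow: its last [p] factors may be
    followed by a new copy of one of them, always at the same distance from the
    end. Repeating this builds a periodic product, hence arbitrary powers. *)
Lemma core_sub_periodic x : (q < p <= k)%N -> core x -> I x.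
Proof.
case/andP=> qp pk /core_split2[x0 [{}x [_ cx ->]]].
have [s [c [sp cc xE]]] := core_splitr p cx.
pose d := (p - q)%N; have d0 : (0 < d)%N by rewrite subn_gt0.
(* The periodic continuation of the last [d] factors of [s]. *)
pose a n := nth x s (if (n < q)%N then n else q + (n - q) %% d).
have a_s : map a (iota 0 p) = s.
  rewrite -[RHS](mkseq_nth x) sp; apply/eq_in_map => n.
  rewrite mem_iota add0n /a => np; case: ltnP => // qn.
  by rewrite modn_small ?subnKC // ltn_sub2r.
have a_d n : (q <= n)%N -> a (n + d)%N = a n.
  move=> qn; rewrite /a !ltnNge qn (leq_trans qn) ?leq_addr //=.
  by rewrite -addnBAC // modnDr.
have grow m : exists2 c, core c & x0 * x = sprod x0 (map a (iota 0 (p + m))) * c.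
  elim: m => [|m [{xE cc}c cc ->]]; first by exists c; rewrite ?addn0 ?a_s.
  set l := sprod x0 (map a (iota 0 m)); set s' := map a (iota m p).
  have ss' : size s' = p by rewrite size_map size_iota.
  have [t [c0 [st cc0 cE]]] := core_splitr (k - p) cc.
  have nth_q : nth l (s' ++ t) q = a (p + m)%N.
    rewrite nth_cat ss' qp (nth_map 0) ?size_iota // nth_iota //.
    by rewrite -a_d ?leq_addl // -addnA subnKC 1?addnC // ltnW.
  have [c' cc' c'E] := core_absorb (map (nth l (s' ++ t)) w') cc0.
  have prodE y : sprod x0 (map a (iota 0 (p + m))) * y = sprod l s' * y.
    by rewrite addnC iotaD map_cat sprod_cat.
  exists c' => //; rewrite prodE cE -sprod_cat w_sprod_prefix //; last first.
    by rewrite size_cat ss' st subnKC.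
  rewrite take_size_cat // nth_q -[sprod _ (_ :: _)]/(sprod (_ * _) _) c'E.
  congr (_ * _); rewrite addnS -addn1 iotaD map_cat sprod_cat /=.
  by congr (_ * _); rewrite addnC iotaD map_cat sprod_cat.
pose G := sprod (a q) (map a (iota q.+1 d.-1)).
have prodG j y : sprod y (map a (iota (q + d * j) d)) = y * G.
  have -> : map a (iota (q + d * j) d) = map a (iota q d).
    elim: j => [|j <-]; first by rewrite muln0 addn0.
    rewrite mulnS addnCA iotaDl -map_comp; apply/eq_in_map => n /=.
    rewrite mem_iota => /andP[qn _]; rewrite addnC a_d //.
    exact: leq_trans (leq_addr _ _) qn.
  by rewrite -[in LHS](prednK d0) sprod_cons.
have prodGn n y : sprod y (map a (iota 0 (q + d * n.+1))) =
    sprod y (map a (iota 0 q)) * pw G n.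
  elim: n => [|n IH].
    by have := prodG 0 (sprod y (map a (iota 0 q)));
      rewrite muln0 addn0 muln1 iotaD map_cat sprod_cat add0n.
  by rewrite mulnSr addnA iotaD map_cat sprod_cat add0n prodG IH pwSr smulA.
have [n Gn] := I_nil G.
have [c1 cc1] := grow (d * n + q)%N.
have -> : (p + (d * n + q) = q + d * n.+1 + q)%N.
  have pE : p = (d + q)%N by rewrite subnK // ltnW.
  by rewrite mulnSr {1}pE !addnA; congr (_ + _)%N; rewrite [(d + q)%N]addnC addnAC.
rewrite iotaD map_cat sprod_cat prodGn => ->.
have [c2 _ ->] := core_absorb (map a (iota (0 + (q + d * n.+1)) q)) cc1.
exact/I_mulr/I_mull.
Qed.

(** If [q > p], a factor found further to the right can be pulled back to the
    place [p]. *)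
Lemma core_pull u b y c : (p < q < k)%N -> core u -> core b -> core c ->
  exists2 c', core c' & u * b * y * c = u * y * c'.
Proof.
case/andP=> pq qk cu cb cc; have pk := ltn_trans pq qk.
have [s [l [sp _ ->]]] := core_splitl p cu.
have [t [b' [st _ bE]]] := core_splitr (q - p).-1 cb.
have qpE : (q - p).-1.+1 = (q - p)%N by rewrite prednK // subn_gt0.
have /spowerP[b0 [tb [tbs ->]]] : spower (q - p).-1.+1 b by [].
have [r [c0 [sr cc0 cE]]] := core_splitr (k - q.+1) cc.
set v := s ++ (b0 :: tb) ++ y :: r.
have sv : size v = k.
  rewrite !size_cat /= sp tbs qpE sr addnA subnKC ?(ltnW pq) //.
  by rewrite addnS -addSn subnKC.
have [c' cc' c'E] := core_absorb (map (nth l v) w') cc0.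
exists c' => //; rewrite cE.
have -> : sprod l s * sprod b0 tb * y = sprod l (s ++ (b0 :: tb) ++ [:: y]).
  by rewrite !sprod_cat /= sprod_mul.
rewrite -sprod_cat -!catA -/v w_sprod_prefix // ?(ltnW pk) //.
rewrite take_size_cat // [nth l v q]nth_cat sp ltnNge (ltnW pq) /=.
rewrite -cat_cons nth_cat /= tbs qpE ltnn subnn.
by rewrite -[LHS]/(sprod (_ * _) _ * _) c'E.
Qed.

(** By counting, some letter occurs twice in [w]: substituting a product with factor
    [y] for it doubles the factor. *)
Lemma core_double l y r : core l -> core r ->
  exists l' m r', [/\ core l', core m, core r' & l * y * r = l' * y * m * y * r'].
Proof.
move=> cl cr; have : ~~ uniq (letters w).
  apply/negP => uw; have /(uniq_leq_size uw) : {subset letters w <= iota 0 k}.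
    by move=> a /(allP w_letters); rewrite mem_iota.
  by rewrite size_iota leqNgt w_size.
move=> /(uniqPn 0)[i [j [ij jw wij]]].
have iw := ltn_trans ij jw.
have ik : (nth 0 (letters w) i < k)%N by apply/(allP w_letters)/mem_nth.
set a := nth 0 (letters w) i in ik wij.
have wE : letters w = take i (letters w) ++ a ::
    drop i.+1 (take j (letters w)) ++ a :: drop j.+1 (letters w).
  rewrite -{1}[letters w](cat_take_drop j) (drop_nth 0 jw) -wij.
  rewrite -{1}[take j _](cat_take_drop i) take_takel 1?ltnW //.
  have ij' : (i < size (take j (letters w)))%N by rewrite size_take jw.
  by rewrite (drop_nth 0 ij') nth_take // -/a -catA.
have [s [l0 [sa cl0 ->]]] := core_splitl a cl.
have [d [r2 [cd cr2 ->]]] := core_split2 cr.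
have [t [c0 [st cc0 cE]]] := core_splitr (k - a.+1) cr2.
set v := s ++ (y * d) :: t.
have sv : size v = k by rewrite size_cat /= sa st addnS -addSn subnKC.
pose f := nth l0 v; have fa : f a = y * d by rewrite /f nth_cat sa ltnn subnn.
exists (sprod l0 (map f (take i (letters w)))).
exists (sprod d (map f (drop i.+1 (take j (letters w))))).
exists (sprod d (map f (drop j.+1 (letters w))) * c0).
split; [exact: core_sprod|exact: core_sprod|exact: core_mull|].
have -> : sprod l0 s * y * (d * r2) = sprod l0 v * c0.
  by rewrite [in RHS]sprod_cat sprod_cons -[RHS]smulA -cE !smulA.
rewrite w_sprod // -/f {1}wE !(map_cat, sprod_cat) /= !(map_cat, sprod_cat) /= fa.
by rewrite !sprod_mul -!smulA.
Qed.

(** Each new copy of [y] is pulled next to the previous ones. *)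
Lemma core_gather u l y r n : (p < q < k)%N -> core u -> core l -> core r ->
  exists c, u * l * y * r = u * pw y n * c.
Proof.
move=> pqk; elim: n u l r => [|n IH] u l r cu cl cr.
  by have [c _ ->] := core_pull y pqk cu cl cr; exists c.
have [l' [m [r' [cl' cm cr' lyrE]]]] := core_double y cl cr.
have [c1 cc1 pullE] := core_pull y pqk cu cl' cm.
have [c cE] := IH (u * y) c1 r' (core_mulr _ cu) cc1 cr'.
by exists c; rewrite -smulA -smulA [l * _]smulA lyrE !smulA pullE cE pwSl !smulA.
Qed.

Lemma core_sub_pull x : (p < q < k)%N -> core x -> I x.
Proof.
move=> pqk /core_split2[u [{}x [cu /core_split2[l [{}x [cl cx ->]]] ->]]].
have [y [r [_ cr ->]]] := core_split2 cx.
have [n Iyn] := I_nil y; have [c cE] := core_gather y n pqk cu cl cr.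
by rewrite !smulA cE; apply/I_mulr/I_mull.
Qed.

End Powers.

(** The letters of [w] are less than [k], so that [w] cannot begin with
    [0, 1, ..., k]. *)
Lemma first_departure k (w : seq nat) :
    (k < size w)%N -> all (fun a => (a < k)%N) w ->
  exists p q w', [/\ w = iota 0 p ++ q :: w', q <> p, (p <= k)%N & (q < k)%N].
Proof.
move=> kw wk; have wkk : (k < size w)%N && (nth 0 w k != k).
  rewrite kw /=; apply/eqP => wkk.
  by have := allP wk _ (mem_nth 0 kw); rewrite wkk ltnn.
have ex : exists i, (i < size w)%N && (nth 0 w i != i) by exists k.
case: (ex_minnP ex) => p /andP[pw wp] pmin.
exists p, (nth 0 w p), (drop p.+1 w); split; last 1 first.
- exact/(allP wk)/mem_nth.
- rewrite -{1}[w](cat_take_drop p) (drop_nth 0 pw); congr (_ ++ _).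
  apply: (@eq_from_nth _ 0); rewrite size_takel ?size_iota ?(ltnW pw) // => i ip.
  rewrite nth_take // nth_iota //; apply/eqP; apply: contraT => wi.
  by have := pmin i; rewrite (ltn_trans ip pw) wi /= leqNgt ip => /(_ isT).
- exact/eqP.
- exact: pmin.
Qed.

Lemma ideal_word_val (S : semigroup) (I : S -> Prop) f w a :
    (forall x y : S, I y -> I (x * y)%sg) -> (forall x y : S, I x -> I (x * y)%sg) ->
  a \in letters w -> I (f a) -> I (word_val f w).
Proof.
move=> Il Ir; case: w => b s; rewrite /word_val /letters inE /= => aw Ia.
have Isprod x t : I x -> I (sprod x t) by elim: t x => //= y t IH x /(Ir x y)/IH.
case/predU1P: aw => [<-|/splitPr[s1 s2]]; first exact: Isprod.
by rewrite map_cat sprod_cat /=; apply/Isprod/Il.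
Qed.

(** A linear word [u] of length [k] can only be identified, modulo an ideal with
    nil quotient, with a permutation of itself, unless all the products of [k]
    elements lie in the ideal. If the two sides of the identity have different
    letters, put an element of the ideal for the odd one; otherwise the other side
    is longer than [u], so that the products of [k] elements are products of any
    number of elements. *)
Lemma nil_ideal_power (S : semigroup) (I : S -> Prop) u v :
    (forall x y : S, I y -> I (x * y)%sg) -> (forall x y : S, I x -> I (x * y)%sg) ->
    (forall x : S, exists n, I (pw x n)) ->
    satisfies S (u, v) -> uniq (letters u) -> ~~ perm_eq (letters u) (letters v) ->
  forall x, spower (size (letters u)) x -> I x.
Proof.
move=> Il Ir Inil uv uU nperm x xu.
have [z Iz] : exists z, I z.
  by have [y] := semigroup_nonempty S; have [n Iy] := Inil y; exists (pw y n).
have [f fu] : exists f, word_val f u = x.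
  case: xu => y [s [su ->]]; exists (fun a => nth y (y :: s) (index a (letters u))).
  rewrite -[LHS]/(sprod (nth y (y :: s) (index u.1 (letters u))) _) /= eqxx /=.
  congr (sprod _ _); apply: (@eq_from_nth _ y).
    by rewrite size_map; case: su.
  move=> i; rewrite size_map => iu; rewrite (nth_map 0) //.
  have /= -> := @index_uniq _ 0 i.+1 (letters u) _ uU => //.
pose g a c := if c == a then z else f c.
have g_out a w : a \notin letters w -> word_val (g a) w = word_val f w.
  by move=> aw; apply: eq_word_val => c cw; rewrite /g; case: eqP cw aw => // -> ->.
have g_in a w : a \in letters w -> I (word_val (g a) w).
  by move=> aw; apply: ideal_word_val aw _ => //; rewrite /g eqxx.
have [/allPn[a av au]|vu] := boolP (~~ all (mem (letters u)) (letters v)).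
  by rewrite -fu -(g_out a u) // (uv (g a)); apply: g_in.
have [/allPn[a au av]|uv'] := boolP (~~ all (mem (letters v)) (letters u)).
  by rewrite -fu (uv f) -(g_out a v) // -(uv (g a)); apply: g_in.
move: vu uv'; rewrite !negbK => /allP vu /allP uv'.
pose k := size (letters u).
have uv_size : (k < size (letters v))%N.
  rewrite ltn_neqAle uniq_leq_size // andbT; apply: contra nperm => /eqP kv.
  have uvi : letters u =i letters v by move=> a; apply/idP/idP => [/uv'|/vu].
  by apply: uniq_perm => //; rewrite (uniq_size_uniq uU uvi) -kv.
(* Renaming the letters of [u] to [0, ..., k-1] in their order allows comparing the
   other side with [u] place by place. *)
pose h a := index a (letters u).
pose w := (h v.1, map h v.2).
have wE : letters w = map h (letters v) by [].
have uE : map h (letters u) = iota 0 k.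
  apply: (@eq_from_nth _ 0); rewrite size_map ?size_iota // => i iu.
  by rewrite (nth_map 0) // nth_iota // /h index_uniq.
have w_eq : satisfies S ((0, iota 1 k.-1), w).
  move=> e; rewrite /= word_val_map -(uv (e \o h)) /= -word_val_map.
  by congr word_val; case: uE => -> ->.
have wk : all (fun a => (a < k)%N) (letters w).
  by rewrite wE all_map; apply/allP => a av; rewrite /= index_mem; apply: vu.
have kw : (k < size (letters w))%N by rewrite wE size_map.
have [p [q [w' [wpq qp pk qk]]]] := first_departure kw wk.
have k0 : (0 < k)%N by [].
have cx := core_power k0 kw w_eq xu.
have [{}qp|{}qp|//] := ltngtP q p.
- by apply: (core_sub_periodic k0 kw w_eq wpq) cx; rewrite ?qp.
- by apply: (core_sub_pull k0 kw wk w_eq wpq) cx; rewrite ?qp.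
Qed.

(** * Commutative varieties given by zero words *)

(** The identities of commutative semigroups in which all the words satisfying [Z] are
    equal to zero. *)
Definition comm_theory (Z : pred (seq nat)) : set identity :=
  [set i | (Z (letters i.1) && Z (letters i.2)) ||
           perm_eq (letters i.1) (letters i.2)].

Lemma comm_theory_zero (Z : pred (seq nat)) u v :
  Z (letters u) -> Z (letters v) -> comm_theory Z (u, v).
Proof. by move=> Zu Zv; apply/orP; left; apply/andP. Qed.

Lemma comm_theory_perm (Z : pred (seq nat)) u v :
  perm_eq (letters u) (letters v) -> comm_theory Z (u, v).
Proof. by move=> uv; apply/orP; right. Qed.

Lemma comm_theory_sub (Z1 Z2 : pred (seq nat)) :
    (forall s, Z1 s -> Z2 s) ->
  (models_variety (comm_theory Z2) <= models_variety (comm_theory Z1))%O.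
Proof.
move=> Z12; apply/SEM_leP => S S2 [u v] /orP[/andP[/Z12 Zu /Z12 Zv]|uv]; apply: S2.
  exact: comm_theory_zero.
exact: comm_theory_perm.
Qed.

Definition COM : SEM := models_variety (comm_theory pred0).

Definition nonlinear_or_long k : pred (seq nat) :=
  fun s => ~~ uniq s || (k <= size s)%N.

(** The variety of commutative semigroups with zero satisfying [x^2 = 0] and
    [x_1 ... x_k = 0]. In particular, [Csq 1] is the trivial variety and [Csq 2]
    is the variety of semigroups with zero multiplication. *)
Definition Csq k : SEM := models_variety (comm_theory (nonlinear_or_long k)).

(** The join of the varieties [Csq k]. *)
Definition Csq_oo : SEM := models_variety (comm_theory (fun s => ~~ uniq s)).

Lemma not_le_comm Z V : ~ (models_variety (comm_theory Z) <= V)%O ->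
  exists u v, [/\ identities_of V (u, v), ~~ Z (letters u) &
                  ~~ perm_eq (letters u) (letters v)].
Proof.
move=> /not_le_models[[u v] Vuv /= /negP].
rewrite negb_or negb_and => /andP[/orP[]nZ nuv]; first by exists u, v.
by exists v, u; split=> //; [exact: identities_ofC Vuv|rewrite perm_sym].
Qed.

Lemma not_le_Csq k V : ~ (Csq k <= V)%O -> exists u v,
  [/\ identities_of V (u, v), uniq (letters u), (size (letters u) < k)%N &
      ~~ perm_eq (letters u) (letters v)].
Proof.
move=> /not_le_comm[u [v [Vuv + nuv]]]; rewrite negb_or negbK -ltnNge.
by case/andP=> uU uk; exists u, v.
Qed.

(** * Products lying in subgroups *)

Section Dual.
Variable S : semigroup.

Definition dual : semigroup.
Proof.
apply: (@Defs.Semigroup S (fun x y => (y * x)%sg)).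
  by move=> x y z; rewrite smulA.
exact: semigroup_nonempty.
Defined.

Definition word_rev (w : word) : word :=
  (last w.1 w.2, rev (belast w.1 w.2)).

Lemma letters_rev w : letters (word_rev w) = rev (letters w).
Proof. by rewrite /letters /= (lastI w.1 w.2) rev_rcons. Qed.

Lemma word_val_dual (f : nat -> S) w :
  @word_val dual f w = word_val f (word_rev w).
Proof.
have sprod_dual (x : S) s : @sprod dual x s = sprod (last x s) (rev (belast x s)).
  elim/last_ind: s => [//|s y IH].
  rewrite last_rcons belast_rcons lastI rev_rcons sprod_cons -IH.
  by rewrite -cats1 (@sprod_cat dual).
by rewrite /word_val sprod_dual last_map belast_map -map_rev.
Qed.

Lemma pw_dual (x : S) n : @pw dual x n = pw x n.
Proof. by elim: n => // n IH; rewrite (@pwSl dual) [RHS]pwSr IH. Qed.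

End Dual.

Lemma word_revK : involutive word_rev.
Proof.
move=> w; have : letters (word_rev (word_rev w)) = letters w.
  by rewrite !letters_rev revK.
by case: w => a s; case: (word_rev _) => b t [-> ->].
Qed.

Lemma satisfies_dual S u v :
  satisfies (dual S) (word_rev u, word_rev v) <-> satisfies S (u, v).
Proof.
by split=> uv f; have := uv f; rewrite /= !(@word_val_dual S) !word_revK.
Qed.

(** The semigroup [{e, a, 0}] where [e] is a left identity of [{e, a}] and all the
    other products are [0]. *)
Inductive P3_type := P3e | P3a | P30.

Definition P3 : semigroup.
Proof.
apply: (@Defs.Semigroup P3_type (fun x y => if x is P3e then y else P30)).
  by case=> [] [].
exact: (inhabits P3e).
Defined.

Section LeftIdentity.
Variables (S : semigroup) (u v : word) (f : nat -> P3).
Hypothesis uv : satisfies S (u, v).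
Hypothesis f_uv : word_val f u <> word_val f v.
Local Open Scope semigroup_scope.

(** Mapping [a] to [x] and [0] to [x^2] nearly embeds [P3] into a semigroup where
    [x = e x], up to the values of the words equal to [0] in [P3]. *)
Definition P3_shadow (p : P3) (y : S) (e x : S) := match p with
  | P3e => y = e
  | P3a => y = x
  | P30 => exists n, y = pw x n.+1 \/ y = pw x n * e
  end.

(** The sides of the identity have different values in [P3], and so correspond to
    elements of [S] of two different kinds; each way of equating them gives one of the
    conclusions. *)
Lemma left_identity_cases (e x : S) : e * e = e -> e * x = x ->
  x * e = x \/ exists n, x = pw x n.+1.
Proof.
move=> ee ex; have epw n : e * pw x n = pw x n.
  by case: n => // n; rewrite pwSl smulA ex.
pose h (p : P3) := match p with P3e => e | P3a => x | P30 => pw x 1 end.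
have Rw w : P3_shadow (word_val f w) (word_val (h \o f) w) e x.
  apply: (@word_val_rel P3 S (fun p y => P3_shadow p y e x)) => [p p' y y'|a];
    last first.
    by rewrite /h /=; case: (f a) => //=; exists 0; left.
  case: p => /= [->|->|[n yn]].
  - case: p' => /= [->|->|[n [->|->]]] //.
      by exists n; left; rewrite epw.
    by exists n; right; rewrite smulA epw.
  - case: p' => /= [->|->|[n [->|->]]].
    + by exists 0; right.
    + by exists 0; left; rewrite pwSl.
    + by exists n.+1; left; rewrite -pwSl.
    + by exists n.+1; right; rewrite smulA -pwSl.
  - have yx m : exists j, y * pw x m = pw x j.+1.
      by case: yn => ->; rewrite -?smulA ?epw pwD; eexists.
    case: p' => /= [->|->|[m [->|->]]].
    + case: yn => ->; first by exists n.+1; right.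
      by exists n; right; rewrite -smulA ee.
    + by have [j ->] := yx 0; exists j; left.
    + by have [j ->] := yx m.+1; exists j; left.
    + by have [j jE] := yx m; exists j.+1; right; rewrite smulA jE.
have := Rw u; have := Rw v; rewrite -(uv (h \o f)) /=.
move: (word_val (h \o f) u) f_uv => y.
case: (word_val f u) (word_val f v) => [] [] //= _.
- by move=> -> xe; right; exists 0; rewrite pwSl pw0 xe ee.
- move=> [n yn] ye; right; rewrite ye in yn.
  case: yn => eE; first by exists n.+1; rewrite -[LHS]ex {1}eE -pwSr.
  by exists n; rewrite -[LHS]ex {1}eE -smulA ex -pwSr.
- by move=> -> xe; right; exists 0; rewrite pwSl pw0 -xe ee.
- move=> [n yn] yx; rewrite yx in yn.
  by case: yn => xE; [right; exists n|left; rewrite xE -smulA ee].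
- move=> ye [n yn]; right; rewrite ye in yn.
  case: yn => eE; first by exists n.+1; rewrite -[LHS]ex {1}eE -pwSr.
  by exists n; rewrite -[LHS]ex {1}eE -smulA ex -pwSr.
- move=> yx [n yn]; rewrite yx in yn.
  by case: yn => xE; [right; exists n|left; rewrite xE -smulA ee].
Qed.
End LeftIdentity.

Section Exponents.
Variable S : semigroup.
Implicit Types x e : S.
Local Open Scope semigroup_scope.

Lemma pw_add x a b n : pw x a = pw x b -> pw x (a + n) = pw x (b + n).
Proof. by move=> ab; elim: n => [|n IH]; rewrite ?addn0 // !addnS !pwSl IH. Qed.

Lemma pw_period x a d m j :
  pw x a = pw x (a + d) -> (a <= m)%N -> pw x m = pw x (m + d * j).
Proof.
move=> ad am; elim: j => [|j ->]; first by rewrite muln0 addn0.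
have /(pw_add (m - a + d * j)%N) := ad.
rewrite (addnA a (m - a)%N) subnKC // => ->; congr pw.
by rewrite mulnS [(a + d)%N]addnC -!addnA (addnA a) subnKC // addnCA.
Qed.

Lemma pw_idempotent x a d : (0 < d)%N -> pw x a = pw x (a + d) ->
  exists n, pw x n * pw x n = pw x n.
Proof.
move=> d0 ad; exists (d * a.+1).-1.
have n1 : (d * a.+1).-1.+1 = (d * a.+1)%N by rewrite prednK // muln_gt0 d0.
rewrite pwD -addnS n1 -(pw_period _ ad) //.
by rewrite -ltnS n1 leq_pmull.
Qed.

(** So [pw x n] is the identity element of a subgroup containing [x]. *)
Lemma pw_unit x n : x = pw x n.+1 ->
  x * pw x n = x /\ pw x n * pw x n = pw x n.
Proof.
move=> xn; split; first by rewrite -pwSl.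
have xxn : x * pw x n = x by rewrite -pwSl.
by case: n xn xxn => // n _ xxn; rewrite {1}pwSr -smulA xxn -pwSr.
Qed.

Lemma word_val_mark x a w :
  word_val (fun b => pw x (b == a)) w = pw x (size w.2 + count_mem a (letters w)).
Proof.
case: w => b s; rewrite /word_val /=.
suff val m : sprod (pw x m) (map (fun b => pw x (b == a)) s) =
    pw x (size s + (m + count_mem a s)) by apply: val.
elim: s m => [|c s IH] m /=; first by rewrite addn0.
by rewrite pwD IH; congr pw; rewrite !addSn !addnS !addnA.
Qed.

(** Give the value [x] to a letter with different multiplicities on the two sides, and
    the value [e] to the other letters. On the side [u] this yields [x] or [e], on
    the other side a different power of [x]. *)
Lemma unit_cases u v e x : satisfies S (u, v) ->
    uniq (letters u) -> ~~ perm_eq (letters u) (letters v) ->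
  e * e = e -> e * x = x -> x * e = x -> exists n, x = pw x n.+1.
Proof.
move=> uv uU /allPn[a _ cuv0] ee ex xe.
have cuv : count_mem a (letters u) != count_mem a (letters v) := cuv0.
pose xp m := if m is n.+1 then pw x n else e.
have xpD m n : xp m * xp n = xp (m + n)%N.
  case: m n => [|m] [|n] //=; rewrite ?addn0 ?addSn ?addnS /= ?pwD //.
    by case: n => // n; rewrite pwSl smulA ex.
  by case: m => // m; rewrite pwSr -smulA xe.
have val w : word_val (fun b => xp (b == a)) w = xp (count_mem a (letters w)).
  case: w => b s; rewrite /word_val /=.
  elim: s (b == a : nat) => [|c s IH] m /=; first by rewrite addn0.
  by rewrite xpD IH addnA.
have := uv (fun b => xp (b == a)); rewrite /= !val.
move: cuv; rewrite (count_uniq_mem _ uU).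
case: (a \in letters u) (count_mem a (letters v)) => [] [|[|n]] //= _.
- by move=> xE; exists 0; rewrite pwSl xE xe.
- by move=> xE; exists n.
- by move=> eE; exists 0; rewrite pwSl -eE xe.
- by move=> eE; exists n.+1; rewrite pwSl -eE xe.
Qed.

End Exponents.

(** If the two sides have different lengths, all the letters may be given the value
    [x]; otherwise some letter has different multiplicities, and it is given the
    value [x^2]. *)
Lemma periodic u v : ~~ perm_eq (letters u) (letters v) -> exists a b,
  (a < b)%N /\ forall S, satisfies S (u, v) -> forall x : S, pw x a = pw x b.
Proof.
pose P a b := forall S, satisfies S (u, v) -> forall x : S, pw x a = pw x b.
have Plt a b : a != b -> P a b -> exists a b, (a < b)%N /\ P a b.
  case: ltngtP => // ab _ abE; first by exists a, b.
  by exists b, a; split=> // S uv x; rewrite abE.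
have [suv|] := eqVneq (size u.2) (size v.2); last first.
  by move=> /Plt suv _; apply: suv => S uv x; rewrite -!word_val_const uv.
case/allPn=> a _ /= cuv; apply: (Plt (size u.2 + count_mem a (letters u))%N
    (size v.2 + count_mem a (letters v))%N); first by rewrite suv eqn_add2l.
by move=> S uv x; rewrite -!word_val_mark uv.
Qed.

(** The ideal [S E S] generated by the idempotents has a nil quotient, so that it
    contains the product in question, say [x = b e c] with [e] idempotent. Then
    [e c] lies in a subgroup, because [e] is a left identity for it; the identity
    element [f] of this subgroup is a right identity for [x], so that [x] lies in a
    subgroup as well. *)
Lemma product_in_subgroup (S : semigroup) (u v u1 v1 u2 v2 : word) f1 f2 :
    satisfies S (u, v) -> uniq (letters u) -> ~~ perm_eq (letters u) (letters v) ->
    satisfies S (u1, v1) -> @word_val P3 f1 u1 <> word_val f1 v1 ->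
    satisfies S (u2, v2) -> @word_val (dual P3) f2 u2 <> word_val f2 v2 ->
  forall x : S, spower (size (letters u)) x -> exists n, x = pw x n.+1.
Proof.
move=> uv uU nuv uv1 nuv1 uv2 nuv2.
have left_id (e x : S) : (e * e)%sg = e -> (e * x)%sg = x -> exists n, x = pw x n.+1.
  move=> ee ex; have [xe|//] := left_identity_cases uv1 nuv1 ee ex.
  exact: (unit_cases uv uU nuv ee ex xe).
have right_id (e x : S) : (e * e)%sg = e -> (x * e)%sg = x -> exists n, x = pw x n.+1.
  move=> ee xe; have uv2' : satisfies (dual S) (word_rev u2, word_rev v2).
    exact/satisfies_dual.
  have nuv2' : @word_val P3 f2 (word_rev u2) <> @word_val P3 f2 (word_rev v2).
    by move=> E; apply: nuv2; rewrite !(@word_val_dual P3).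
  have [ex|[n xn]] := @left_identity_cases (dual S) _ _ _ uv2' nuv2' e x ee xe.
    exact: (unit_cases uv uU nuv ee ex xe).
  by exists n; rewrite -[RHS]pw_dual.
pose I (x : S) := exists b e c : S, (e * e)%sg = e /\ x = (b * e * c)%sg.
have [a [b [ab /(_ S uv) abE]]] := periodic nuv.
have Inil (x : S) : exists n, I (pw x n).
  have [||n xn] := @pw_idempotent S x a (b - a); rewrite ?subn_gt0 ?subnKC // 1?ltnW //.
  by exists n, (pw x n), (pw x n), (pw x n); rewrite !xn.
have Il (x y : S) : I y -> I (x * y)%sg.
  by move=> [p [e [c [ee ->]]]]; exists (x * p)%sg, e, c; rewrite !smulA.
have Ir (x y : S) : I x -> I (x * y)%sg.
  by move=> [p [e [c [ee ->]]]]; exists p, e, (c * y)%sg; rewrite !smulA.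
move=> x /(nil_ideal_power Il Ir Inil uv uU nuv)[p [e [c [ee ->]]]].
have [|n /pw_unit[]] := left_id e (e * c)%sg ee; first by rewrite smulA ee.
set f := pw _ _ => ecf ff; apply: (right_id f) => //.
by rewrite -[X in (X * f)%sg]smulA -smulA ecf smulA.
Qed.

(** * Completely regular powers *)

Lemma cr_identity (S : semigroup) (A : set S) x : completely_regular A -> A x ->
  exists e : S, (e * x)%sg = x /\ (x * e)%sg = x.
Proof.
by move=> [F [FG ->]] [G /FG[_ [e [_ eG _]]] /eG[ex xe]]; exists e.
Qed.

(** The powers of [x] form a subgroup, and they remain in the [k]-th power of [S]. *)
Lemma completely_regular_spower (S : semigroup) k : (0 < k)%N ->
    (forall x : S, spower k x -> exists n, x = pw x n.+1) ->
  completely_regular (@spower S k).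
Proof.
move=> k0 kx; exists [set G | is_subgroup G /\ G `<=` @spower S k].
split=> [G []//|]; apply/seteqP; split=> [x xk|x [G [_ Gk]]]; last exact: Gk.
have [n xn] := kx _ xk; have [xe ee] := pw_unit xn.
exists [set pw x j | j in setT]; last by exists 0.
split=> [|_ [j _ <-]]; last first.
  case: j => // j; rewrite pwSl; apply: (@spower_le _ _ (k + j.+1)).
    by rewrite k0 leq_addr.
  by apply: spowerM xk _; apply/spowerP; exists x, (nseq j x); rewrite size_nseq.
have pwe j : (pw x j * pw x n)%sg = pw x j.
  by case: j => // j; rewrite pwSr -smulA xe.
have epw j : (pw x n * pw x j)%sg = pw x j by rewrite pwD addnC -pwD.
split=> [_ _ [i _ <-] [j _ <-]|]; first by rewrite pwD; exists (i + j).+1.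
exists (pw x n); split=> [|_ [j _ <-]//|_ [j _ <-]]; first by exists n.
have jn : (j <= (n.+1 * j.+2).-2)%N.
  by rewrite mulSn !addSn /= leq_addr.
have eN : (pw x j * pw x ((n.+1 * j.+2).-2 - j))%sg = pw x n.
  rewrite pwD subnKC // -[_.-2]/(_.-1.-1) prednK; last by rewrite mulSn !addSn.
  by rewrite -pw_pw; elim: (j.+1) => // i IH; rewrite pwSl IH.
exists (pw x ((n.+1 * j.+2).-2 - j)); split; [by eexists|by []|].
by rewrite pwD addnC -pwD.
Qed.

(** * Free objects of the commutative varieties *)

(** The conditions under which the words satisfying [Z] are the words equal to zero
    in some commutative variety. *)
Definition zero_words (Z : pred (seq nat)) : Prop :=
  [/\ forall s t, perm_eq s t -> Z s = Z t,
      forall s t, Z s -> Z (s ++ t) &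
      forall g s, (forall a, (0 < size (g a))%N) -> Z s -> Z (flatten (map g s))].

Lemma zero_words_nonlinear : zero_words (fun s => ~~ uniq s).
Proof.
split=> [s t /perm_uniq->//|s t|g s g0]; first by rewrite cat_uniq negb_and => ->.
apply: contra; elim: s => //= a s IH; rewrite cat_uniq => /and3P[_ ga /IH->].
rewrite andbT; apply: contra ga => as_; apply/hasP.
have := g0 a; case ga: (g a) => [//|b t] _; exists b; last by rewrite inE eqxx.
by apply/flattenP; exists (g a); [apply: map_f|rewrite ga inE eqxx].
Qed.

Lemma zero_words_long k : zero_words (fun s => (k <= size s)%N).
Proof.
split=> [s t /perm_size->//|s t ks|g s g0 ks].
  by rewrite size_cat (leq_trans ks) ?leq_addr.
apply: leq_trans ks _; rewrite size_flatten.
by elim: s => //= a s IH; rewrite -add1n leq_add.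
Qed.

Lemma zero_wordsU Z1 Z2 : zero_words Z1 -> zero_words Z2 ->
  zero_words (fun s => Z1 s || Z2 s).
Proof.
move=> [p1 c1 s1] [p2 c2 s2]; split=> [s t st|s t|g s g0].
- by rewrite (p1 s t) ?(p2 s t).
- by case/orP=> [/c1|/c2] ->; rewrite ?orbT.
- by case/orP=> [/s1|/s2] ->; rewrite ?orbT.
Qed.

Lemma zero_words_Csq k : zero_words (nonlinear_or_long k).
Proof. exact: zero_wordsU zero_words_nonlinear (zero_words_long k). Qed.

Section FreeCommutative.
Variable Z : pred (seq nat).
Hypothesis zZ : zero_words Z.

Let Z_perm s t : perm_eq s t -> Z s = Z t. Proof. by case: zZ => + _ _; apply. Qed.

Let Z_cat s t : Z s -> Z (s ++ t). Proof. by case: zZ => _ + _; apply. Qed.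

Let Z_subst g s : (forall a, (0 < size (g a))%N) -> Z s -> Z (flatten (map g s)).
Proof. by case: zZ => _ _; apply. Qed.

Definition comm_rel (u v : word) : bool :=
  (Z (letters u) && Z (letters v)) || perm_eq (letters u) (letters v).

Lemma comm_relP u v : reflect (comm_theory Z (u, v)) (comm_rel u v).
Proof. exact: idP. Qed.

Let comm_refl : reflexive comm_rel.
Proof. by move=> u; rewrite /comm_rel perm_refl orbT. Qed.

Let comm_sym : symmetric comm_rel.
Proof. by move=> u v; rewrite /comm_rel andbC perm_sym. Qed.

Let comm_trans : transitive comm_rel.
Proof.
move=> v u w; rewrite /comm_rel.
case/orP=> [/andP[Zu Zv]|uv] /orP[/andP[Zv' Zw]|vw]; first by rewrite Zu Zw.
- by rewrite Zu -(Z_perm vw) Zv.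
- by rewrite (Z_perm uv) Zv' Zw.
- by rewrite (perm_trans uv vw) orbT.
Qed.

Let comm_cat u u' v v' : comm_rel u u' -> comm_rel v v' ->
  comm_rel (word_cat u v) (word_cat u' v').
Proof.
have Z_catr s t : Z t -> Z (s ++ t).
  move=> Zt; have /Z_perm-> : perm_eq (s ++ t) (t ++ s) by rewrite perm_catC.
  exact: Z_cat.
rewrite /comm_rel !letters_cat.
case/orP=> [/andP[Zu Zu'] _|uu']; first by rewrite !Z_cat.
case/orP=> [/andP[Zv Zv']|vv']; first by rewrite !Z_catr.
by rewrite perm_cat ?orbT.
Qed.

(** The elements are the classes of words, given by canonical representatives: a
    quotient type built as a choice type would lie in too large a universe to be
    the carrier of a semigroup. *)
Let nf (w : word) : word := choose (comm_rel w) w.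

Let nfP w : comm_rel w (nf w).
Proof. exact: chooseP (comm_refl w). Qed.

Let eq_nf u v : (nf u = nf v) <-> comm_rel u v.
Proof.
split=> [uv|uv].
  by apply: comm_trans (nfP u) _; rewrite uv comm_sym.
have uvE : comm_rel u =1 comm_rel v.
  by move=> w; apply/idP/idP; apply: comm_trans => //; rewrite comm_sym.
by rewrite /nf (eq_choose uvE); apply: choose_id; rewrite // comm_sym.
Qed.

Let nf_id w : nf (nf w) == nf w.
Proof. by apply/eqP/eq_nf; rewrite comm_sym. Qed.

Definition free_comm_type : Type := {w : word | nf w == w}.

Definition free_class (w : word) : free_comm_type := exist _ (nf w) (nf_id w).

Let free_classP u v : (free_class u = free_class v) <-> comm_rel u v.
Proof.
rewrite -eq_nf; split=> [/(congr1 val)//|uv].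
exact: val_inj.
Qed.

Let free_class_val (x : free_comm_type) : free_class (sval x) = x.
Proof. by apply: val_inj => /=; apply/eqP; case: x. Qed.

Let free_class_cat (u v : word) : free_class (word_cat u v) =
  free_class (word_cat (sval (free_class u)) (sval (free_class v))).
Proof. by apply/free_classP/comm_cat; apply: nfP. Qed.

Definition free_comm : semigroup.
Proof.
pose mul (x y : free_comm_type) := free_class (word_cat (sval x) (sval y)).
refine (@Defs.Semigroup free_comm_type mul _ (inhabits (free_class (0, [::])))).
move=> x y z; rewrite /mul -[x in LHS]free_class_val -[z in RHS]free_class_val.
rewrite -!free_class_cat; congr free_class; exact: (@smulA free_semigroup).
Defined.

Let free_classM :
  {morph (free_class : free_semigroup -> free_comm) : u v / (u * v)%sg}.
Proof. by move=> u v; apply: free_class_cat. Qed.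

Lemma free_comm_val (f : nat -> free_comm) w :
  word_val f w = free_class (subst (fun a => sval (f a)) w).
Proof.
rewrite /subst (hom_word_val _ _ free_classM).
by apply: eq_word_val => a _; rewrite /= free_class_val.
Qed.

Lemma free_comm_member : members (models_variety (comm_theory Z)) free_comm.
Proof.
move=> [u v] /comm_relP uv f; rewrite /= !free_comm_val.
apply/free_classP; rewrite /comm_rel !letters_subst.
case/orP: uv => [/andP[Zu Zv]|uv]; first by rewrite !Z_subst.
by rewrite perm_flatten ?orbT // perm_map.
Qed.

Definition free_letter (a : nat) : free_comm := free_class (a, [::]).

Lemma free_comm_letter w : word_val free_letter w = free_class w.
Proof. by rewrite -[in RHS](word_val_letter w) (hom_word_val _ _ free_classM). Qed.

Lemma identities_of_comm i :
  identities_of (models_variety (comm_theory Z)) i <-> comm_theory Z i.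
Proof.
split=> [Zi|Zi S]; last exact.
have := Zi _ free_comm_member free_letter.
by rewrite !free_comm_letter => /free_classP; case: (i).
Qed.

(** Multiplying lengthens a word, and a nonzero word equals only words of the same
    length. *)
Lemma free_comm_not_unit w (e : free_comm) :
  ~~ Z (letters w) -> ((free_class w : free_comm) * e)%sg <> free_class w.
Proof.
move=> nZw; rewrite -[e]free_class_val -free_classM => /free_classP.
rewrite /comm_rel (negPf nZw) andbF /= letters_cat => /perm_size.
by rewrite size_cat /= => /eqP; rewrite -[X in _ == X]addn0 eqn_add2l.
Qed.

End FreeCommutative.

(** * The three obstructions *)

Lemma iota_product k (S : semigroup) (f : nat -> S) : (0 < k)%N ->
  spower k (word_val f (0, iota 1 k.-1)).
Proof.
move=> k0; have := spower_word_val f (0, iota 1 k.-1).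
by rewrite /= size_iota prednK.
Qed.

Lemma iota_letters k : (0 < k)%N -> letters (0, iota 1 k.-1) = iota 0 k.
Proof. by case: k. Qed.

(** In the free object, a product of [k] distinct generators is not even divisible by
    itself times another element. *)
Lemma comm_not_cr Z k (V : SEM) : zero_words Z -> (0 < k)%N -> ~~ Z (iota 0 k) ->
    (models_variety (comm_theory Z) <= V)%O ->
  exists2 S, members V S & ~ completely_regular (@spower S k).
Proof.
move=> zZ k0 Zk ZV; exists (free_comm zZ).
  exact: members_sub ZV (@free_comm_member _ zZ).
move=> /cr_identity/(_ (iota_product (free_letter zZ) k0)).
rewrite free_comm_letter => -[e [_]].
by apply: free_comm_not_unit; rewrite iota_letters.
Qed.

(** The element [a = e ... e a] has no right identity. *)
Lemma P3_not_cr k : (0 < k)%N -> ~ completely_regular (@spower P3 k).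
Proof.
move=> k0 /cr_identity cr; have /cr[e [_ //]] : @spower P3 k P3a.
case: k k0 {cr} => // k _; elim: k => [|k IH]; first by exists P3a, [::].
by rewrite -add1n; apply: (@spowerM P3 _ _ P3e P3a) IH; exists P3e, [::].
Qed.

Lemma dual_P3_not_cr k : (0 < k)%N -> ~ completely_regular (@spower (dual P3) k).
Proof.
move=> k0 /cr_identity cr; have /cr[e [//]] : @spower (dual P3) k P3a.
case: k k0 {cr} => // k _; elim: k => [|k IH]; first by exists P3a, [::].
by rewrite -addn1; apply: (@spowerM (dual P3) _ _ P3a P3e) IH _; exists P3e, [::].
Qed.

Lemma all_powers_cr_identity (V : SEM) k u v : (0 < k)%N ->
    identities_of V (u, v) -> uniq (letters u) -> (size (letters u) <= k)%N ->
    ~~ perm_eq (letters u) (letters v) ->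
    ~ (var P3 <= V)%O -> ~ (var (dual P3) <= V)%O ->
  all_powers_cr k V.
Proof.
move=> k0 Vuv uU uk nuv /not_var_le[[u1 v1] [f1 [V1 n1]]].
move=> /not_var_le[[u2 v2] [f2 [V2 n2]]] S VS.
apply: completely_regular_spower => // x /(@spower_le _ (size (letters u))) kx.
exact: (product_in_subgroup (Vuv _ VS) uU nuv (V1 _ VS) n1 (V2 _ VS) n2 (kx uk)).
Qed.

(** The identity that [V] has when it does not contain [Csq k.+1] involves a linear word
    of length at most [k], as is needed to decide about the products of [k] elements. *)
Theorem all_powers_crE k (V : SEM) : (0 < k)%N -> all_powers_cr k V <->
  [/\ ~ (var P3 <= V)%O, ~ (var (dual P3) <= V)%O & ~ (Csq k.+1 <= V)%O].
Proof.
move=> k0; split=> [Vk|[nP nQ /not_le_Csq[u [v [Vuv uU uk nuv]]]]]; last first.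
  exact: all_powers_cr_identity Vuv uU uk nuv nP nQ.
split=> [/var_le/Vk|/var_le/Vk|]; [exact: P3_not_cr|exact: dual_P3_not_cr|].
move=> /(comm_not_cr (zero_words_Csq _) k0)[|S /Vk//].
by rewrite negb_or negbK iota_uniq size_iota -ltnNge ltnSn.
Qed.

(** Here the length of the linear word is arbitrary, but it is the same for all the
    semigroups of [V]. *)
Theorem has_cr_powerE (V : SEM) : has_cr_power V <->
  [/\ ~ (var P3 <= V)%O, ~ (var (dual P3) <= V)%O & ~ (Csq_oo <= V)%O].
Proof.
split=> [Vcr|[nP nQ /not_le_comm[u [v [Vuv uU nuv]]]]]; last first.
  move=> S VS; exists (size (letters u)); split=> //.
  by apply: all_powers_cr_identity Vuv _ _ nuv nP nQ _ VS => //; rewrite negbK in uU.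
split=> [/var_le/Vcr[k []]|/var_le/Vcr[k []]|];
  [exact: P3_not_cr|exact: dual_P3_not_cr|].
pose S := free_comm zero_words_nonlinear.
move=> /members_sub/(_ (@free_comm_member _ zero_words_nonlinear))/Vcr[k [k0]].
move=> /cr_identity/(_ (iota_product (free_letter zero_words_nonlinear) k0)).
rewrite free_comm_letter => -[e [_]]; apply: free_comm_not_unit.
by rewrite negbK iota_letters ?iota_uniq.
Qed.

(** * Small semigroups *)

(** The positive integers under addition, shifted so that [pw x] is a homomorphism
    from them. *)
Definition exponents : semigroup.
Proof.
apply: (@Defs.Semigroup nat (fun m n => (m + n).+1)); last exact: (inhabits 0).
by move=> m n p; rewrite addnS addSn addnA.
Defined.

Lemma pw_exponents (S : semigroup) (x : S) (g : nat -> exponents) w :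
  pw x (word_val g w) = word_val (fun a => pw x (g a)) w.
Proof.
by rewrite (@hom_word_val exponents S (pw x)) // => m n; rewrite pwD.
Qed.

(** The type of ordinals lies in too large a universe to be the carrier of a
    semigroup. *)
Definition residue_type n : Type := {m : nat | (m < n.+1)%N}.

Definition to_residue n m : residue_type n :=
  exist _ (m %% n.+1) (ltn_pmod m (ltn0Sn n)).

Lemma eq_to_residue n a b : (to_residue n a = to_residue n b) <-> a = b %[mod n.+1].
Proof. by split=> [/(congr1 val)|ab]; last exact: val_inj. Qed.

Lemma to_residue_val n (x : residue_type n) : to_residue n (sval x) = x.
Proof. by apply: val_inj; rewrite /= modn_small //; case: x. Qed.

Definition cyclic (n : nat) : semigroup.
Proof.
refine (@Defs.Semigroup (residue_type n)
  (fun x y => to_residue n (sval x + sval y)) _ (inhabits (to_residue n 0))).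
by move=> x y z; apply/eq_to_residue; rewrite /= modnDmr modnDml addnA.
Defined.

(** The abelian groups of exponent dividing [n]. *)
Definition Zv n : SEM := var (cyclic n.-1).

Definition residue n (m : exponents) : cyclic n := to_residue n m.+1.

Lemma residueM n : {morph @residue n : a b / (a * b)%sg}.
Proof.
by move=> a b; apply/eq_to_residue; rewrite /= modnDm addnS.
Qed.

Lemma eq_residue n a b : (@residue n a = residue n b) <-> a.+1 = b.+1 %[mod n.+1].
Proof. exact: eq_to_residue. Qed.

Lemma residue_pw n m : pw (residue n 0) m = residue n m.
Proof.
have -> : residue n m = residue n (@pw exponents 0 m).
  by congr residue; elim: m => // m {1}->; rewrite pwSl.
by elim: m => // m IH; rewrite !pwSl residueM IH.
Qed.

Lemma residue_onto n (k : cyclic n) : exists m, k = residue n m.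
Proof.
exists (sval k + n)%N; rewrite -[LHS]to_residue_val; apply/eq_to_residue.
by rewrite -addnS modnDr.
Qed.

Lemma cyclic_comm n (x y : cyclic n) : (x * y = y * x)%sg.
Proof. by apply/eq_to_residue; rewrite addnC. Qed.

Lemma cyclic_identity n (x y : cyclic n) : (pw x n * y)%sg = y.
Proof.
have [k ->] := residue_onto x; have [m ->] := residue_onto y.
have pwk j : pw (residue n k) j = residue n (k.+1 * j.+1).-1.
  elim: j => [|j IH]; first by rewrite muln1.
  rewrite pwSl IH -residueM; congr residue; rewrite -[LHS]/(k + (k.+1 * j.+1).-1).+1.
  by rewrite (mulnS k.+1 j.+1) addSn succnK -addnS prednK ?muln_gt0.
rewrite pwk -residueM; apply/eq_residue.
rewrite -[(_ * _)%sg]/(((k.+1 * n.+1).-1 + m).+1).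
by rewrite -addnS -addSn prednK ?muln_gt0 // modnMDl.
Qed.

Section Pairs.
Variables (op : bool -> bool -> bool) (opA : associative op).

Definition bool_semigroup : semigroup :=
  @Defs.Semigroup bool op opA (inhabits true).

(** The failing identity takes both values in the semigroup [bool_semigroup]. *)
Lemma not_le_bool (V : SEM) (S : semigroup) (h : bool -> S) :
    ~ (var bool_semigroup <= V)%O -> members V S ->
  {morph h : b c / op b c >-> (b * c)%sg} -> h true = h false.
Proof.
move=> /not_var_le[i [f [Vi fi]]] VS hM.
have := Vi _ VS (h \o f).
rewrite -!(@hom_word_val bool_semigroup S h) //.
by move: fi; case: (word_val f i.1) (word_val f i.2) => [] [].
Qed.

End Pairs.

Lemma left_zeroA : associative (fun b _ : bool => b). Proof. by []. Qed.
Lemma right_zeroA : associative (fun _ b : bool => b). Proof. by []. Qed.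

Definition SL : SEM := var (bool_semigroup andbA).
Definition LZ : SEM := var (bool_semigroup left_zeroA).
Definition RZ : SEM := var (bool_semigroup right_zeroA).

Section PairsIn.
Variables (V : SEM) (S : semigroup) (x g : S).
Hypothesis VS : members V S.
Local Open Scope semigroup_scope.

Lemma not_le_SL : ~ (SL <= V)%O -> x * x = x -> g * g = g -> x * g = g -> g * x = g ->
  x = g.
Proof.
move=> nV xx gg xg gx.
by apply: (@not_le_bool _ andbA V S (fun b => if b then x else g)) => // -[] [].
Qed.

Lemma not_le_LZ : ~ (LZ <= V)%O -> x * x = x -> g * g = g -> x * g = x -> g * x = g ->
  x = g.
Proof.
move=> nV xx gg xg gx.
by apply: (@not_le_bool _ left_zeroA V S (fun b => if b then x else g)) => // -[] [].
Qed.

Lemma not_le_RZ : ~ (RZ <= V)%O -> x * x = x -> g * g = g -> x * g = g -> g * x = x ->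
  x = g.
Proof.
move=> nV xx gg xg gx.
by apply: (@not_le_bool _ right_zeroA V S (fun b => if b then x else g)) => // -[] [].
Qed.

End PairsIn.

(** A letter with value [k] in the cyclic group is replaced by a power of [x] whose
    exponent is congruent to [k]. *)
Lemma not_le_Zv n (V : SEM) : (0 < n)%N -> ~ (Zv n <= V)%O -> exists a b,
  a <> b %[mod n] /\ forall (S : semigroup) (x : S), members V S -> pw x a = pw x b.
Proof.
case: n => // n _ /not_var_le[i [f [Vi fi]]].
pose g : nat -> exponents := fun a => (sval (f a) + n)%N.
have fg : f = residue n \o g.
  apply/funext => a; rewrite -[LHS]to_residue_val; apply/eq_to_residue.
  by rewrite /g -addnS modnDr.
exists (word_val g i.1), (word_val g i.2); split=> [ab|S x VS].
  have fE w : word_val f w = residue n (word_val g w).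
    by rewrite (hom_word_val _ _ (@residueM n)) fg.
  apply: fi; rewrite !fE; apply/eq_residue/eqP.
  by rewrite -(addn1 (word_val g i.1)) -(addn1 (word_val g i.2)) eqn_modDr; apply/eqP.
by rewrite !pw_exponents Vi.
Qed.

(** * Commutative varieties *)

Definition commutative_sg (S : semigroup) : Prop := forall x y : S, (x * y = y * x)%sg.

Section Commutative.
Variable S : semigroup.
Hypothesis S_comm : commutative_sg S.
Local Open Scope semigroup_scope.

Lemma perm_sprod (f : nat -> S) l s t :
  perm_eq s t -> sprod l (map f s) = sprod l (map f t).
Proof.
elim: s l t => [|a s IH] l t st; first by have /perm_size := st; case: t {st}.
have at_ : a \in t by rewrite -(perm_mem st) mem_head.
case/splitPr: at_ st => t1 t2; rewrite perm_sym perm_catC /= perm_cons => st.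
rewrite map_cat sprod_cat /= (IH _ (t1 ++ t2)); last by rewrite perm_sym perm_catC.
rewrite map_cat sprod_cat; congr sprod; elim: t1 l {st} => //= b t1 IH1 l.
by rewrite -IH1 -!smulA (S_comm (f a)).
Qed.

Lemma perm_word_val (f : nat -> S) u v :
  perm_eq (letters u) (letters v) -> word_val f u = word_val f v.
Proof.
case: u v => a s [b t]; rewrite /letters /word_val /= => st.
have [ab|ab] := eqVneq a b.
  by move: st; rewrite ab perm_cons => /perm_sprod->.
have at_ : a \in t.
  by have := perm_mem st a; rewrite mem_head !inE (negPf ab) /= => <-.
case/splitPr: at_ st => t1 t2 st.
have t12 : perm_eq (t1 ++ a :: t2) (a :: t1 ++ t2).
  by rewrite -cat1s perm_catCA.
have {}st : perm_eq s (b :: t1 ++ t2).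
  rewrite -(perm_cons a); apply: perm_trans st _.
  apply: (@perm_trans _ (b :: a :: t1 ++ t2)); first by rewrite perm_cons.
  exact: permEl (perm_catCA [:: b] [:: a] _).
by rewrite (perm_sprod _ _ st) (perm_sprod _ _ t12) /= S_comm.
Qed.

Lemma COM_sg : members COM S.
Proof. by move=> [u v] uv f; apply: perm_word_val. Qed.

End Commutative.

Lemma members_COM S : members COM S <-> commutative_sg S.
Proof.
split=> [SC x y|/COM_sg//].
have /SC/(_ (nth x [:: x; y])) : comm_theory pred0 ((0, [:: 1]), (1, [:: 0])) by [].
by [].
Qed.

Lemma var_le_COM S : commutative_sg S -> (var S <= COM)%O.
Proof. by move=> SC; apply/var_le/members_COM. Qed.

Lemma le_COM (V : SEM) (S : semigroup) :
  (V <= COM)%O -> members V S -> commutative_sg S.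
Proof. by move=> VC VS; apply/members_COM/(members_sub VC). Qed.

Lemma var_satisfies S T i : satisfies S i -> members (var S) T -> satisfies T i.
Proof. by move=> Si; apply=> _ ->. Qed.

(** * Periodic and aperiodic varieties *)

Lemma COM_periodic (V : SEM) : ~ (COM <= V)%O ->
  exists a d, (0 < d)%N /\
    forall (S : semigroup) (x : S), members V S -> pw x a = pw x (a + d).
Proof.
move=> /not_le_comm[u [v [Vuv _ /periodic[a [b [ab abE]]]]]].
exists a, (b - a)%N; rewrite subn_gt0 subnKC ?(ltnW ab) //; split=> // S x VS.
exact/abE/Vuv.
Qed.

Lemma pw_gcd (S : semigroup) (x : S) a c b d N : (0 < c)%N ->
    pw x a = pw x (a + c) -> pw x b = pw x (b + d) -> (a <= N)%N -> (b <= N)%N ->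
  pw x N = pw x (N + gcdn c d).
Proof.
move=> c0 ac bd aN bN; case: (egcdnP d c0) => km kn gE _.
rewrite [RHS](pw_period kn bd) 1?(leq_trans bN) ?leq_addr //.
by rewrite (pw_period km ac aN) mulnC gE [(d * kn)%N]mulnC addnAC addnA.
Qed.

(** A period greater than 1 can be decreased: let [p] be a prime divisor of it; an
    identity failing in the group of order [p] yields an equality of powers of [x]
    whose exponents differ by a number not divisible by [p]. *)
Lemma aperiodic (V : SEM) : ~ (COM <= V)%O -> (forall p, prime p -> ~ (Zv p <= V)%O) ->
  exists N, forall (S : semigroup) (x : S), members V S -> pw x N = pw x N.+1.
Proof.
move=> /COM_periodic[a [d [d0 ad]]] nZ.
elim: d {-2}d (leqnn d) a d0 ad => [|n IH] d dn a d0 ad.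
  by move: d0; rewrite ltnNge dn.
have [d1|d1] := eqVneq d 1.
  by exists a => S x /ad->; rewrite d1 addn1.
have p_pr : prime (pdiv d) by rewrite pdiv_prime // ltn_neqAle eq_sym d1.
have [b [c [bc bcE]]] := not_le_Zv (prime_gt0 p_pr) (nZ _ p_pr).
wlog bc_lt : b c bc bcE / (b < c)%N.
  move=> H; have [/H|/H|bcE'] := ltngtP b c; first by apply.
    by apply=> [|S x VS]; [exact: nesym|rewrite bcE].
  by rewrite bcE' in bc.
pose g := gcdn d (c - b).
have gd : (g < d)%N.
  rewrite ltn_neqAle dvdn_leq ?dvdn_gcdl // andbT; apply/eqP => gd.
  apply: bc; apply/esym/eqP; rewrite eqn_mod_dvd ?(ltnW bc_lt) //.
  by apply: dvdn_trans (pdiv_dvd d) _; rewrite -{1}gd dvdn_gcdr.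
apply: (IH g _ (maxn a b)); first by rewrite -ltnS (leq_trans gd).
  by rewrite gcdn_gt0 d0.
move=> S x VS; apply: (pw_gcd d0 (ad _ _ VS) (b := b));
  rewrite ?leq_max ?leqnn ?orbT //.
by rewrite subnKC ?(ltnW bc_lt) // bcE.
Qed.

(** * The atoms *)

Lemma Csq1P (V : SEM) :
  (V <= Csq 1)%O <-> forall (S : semigroup) (x y : S), members V S -> x = y.
Proof.
split=> [/SEM_leP V1 S x y /V1 S1|Vtriv].
  have /S1/(_ (nth x [:: x; y])) :
    comm_theory (nonlinear_or_long 1) ((0, [::]), (1, [::])) by [].
  by [].
by apply/SEM_leP => S VS i _ f; apply: Vtriv.
Qed.

Lemma Csq1_le (V : SEM) : (Csq 1 <= V)%O.
Proof.
apply/SEM_leP => S S1; apply/membersE => i _ f.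
by have /Csq1P := lexx (Csq 1); apply.
Qed.

Lemma eq_Csq1 (V : SEM) :
  (forall (S : semigroup) (x y : S), members V S -> x = y) -> V = Csq 1.
Proof. by move=> /Csq1P V1; apply: le_anti; rewrite V1 Csq1_le. Qed.

Lemma neq_Csq1 (S : semigroup) (x y : S) (V : SEM) :
  members V S -> x <> y -> V <> Csq 1.
Proof.
move=> VS xy V1; have /Csq1P triv : (V <= Csq 1)%O by rewrite V1.
exact/xy/(triv S).
Qed.

(** An identity failing in the semigroups with zero multiplication has a single letter
    on one side. *)
Lemma not_le_Csq2 (V : SEM) : ~ (Csq 2 <= V)%O ->
  exists m, forall (S : semigroup) (x : S), members V S -> x = pw x m.+1.
Proof.
move=> /not_le_Csq[[a s] [[b t] [Vuv _]]]; case: s Vuv => // Vuv _.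
case: t Vuv => [|c t] Vuv ab; last first.
  by exists (size t) => S x VS; have := Vuv S VS (fun=> x); rewrite /= !word_val_const.
exists 0 => S x VS; have := Vuv S VS (fun c => if c == a then x else pw x 1).
by rewrite /word_val /= eqxx; case: eqP ab => // ->; rewrite perm_refl.
Qed.

Lemma Zv_le_COM n : (Zv n <= COM)%O.
Proof. by apply: var_le_COM => x y; apply: cyclic_comm. Qed.

Lemma SL_le_COM : (SL <= COM)%O.
Proof. by apply: var_le_COM => x y; apply: andbC. Qed.

Lemma le_of_comm Z : (models_variety (comm_theory Z) <= COM)%O.
Proof. exact: comm_theory_sub. Qed.

Lemma aperiodic_idempotent (S : semigroup) (x : S) n N :
  x = pw x n.+1 -> pw x N = pw x N.+1 -> (x * x)%sg = x.
Proof.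
move=> xn NE; have xm : pw x 0 = pw x (0 + n.+1) by rewrite add0n -xn.
rewrite -[RHS]/(pw x 0) -[LHS]/(pw x 1).
rewrite (pw_period N xm (leqnn 0)) (pw_period N xm (leq0n 1)) add1n add0n.
have /(pw_add (n.+1 * N - N)%N) := NE.
by rewrite addSn subnKC ?leq_pmull.
Qed.

(** Every nontrivial variety contains one of these: without all of them, the
    semigroups are bands, then rectangular bands, then trivial. *)
Lemma atoms_below (V : SEM) : V <> Csq 1 ->
    ~ (Csq 2 <= V)%O -> ~ (SL <= V)%O -> (forall p, prime p -> ~ (Zv p <= V)%O) ->
  (LZ <= V)%O \/ (RZ <= V)%O.
Proof.
move=> V1 n1 n2 n3; apply: contrapT => nV; apply: V1; apply: eq_Csq1.
have n4 : ~ (LZ <= V)%O by move=> ?; apply: nV; left.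
have n5 : ~ (RZ <= V)%O by move=> ?; apply: nV; right.
have nC : ~ (COM <= V)%O by move=> /(le_trans SL_le_COM).
have [m mE] := not_le_Csq2 n1; have [N NE] := aperiodic nC n3.
move=> S x y VS.
have band (z : S) : (z * z)%sg = z.
  exact: aperiodic_idempotent (mE _ _ VS) (NE _ _ VS).
have rect (z t : S) : z = (z * t * z)%sg.
  apply: (not_le_SL VS n2) => //.
  - by rewrite !smulA band.
  - by rewrite -smulA band.
have left_eq (z t : S) : z = (t * z)%sg.
  by apply: (not_le_LZ VS n4) => //; rewrite ?smulA -?rect // -smulA band.
have right_eq (z t : S) : z = (z * t)%sg.
  by apply: (not_le_RZ VS n5) => //; rewrite ?smulA -?rect ?band.
by rewrite [LHS](right_eq x y) -left_eq.
Qed.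

(** * Varieties above a single atom *)

Definition only (A V : SEM) : Prop :=
  forall U : SEM, (U <= V)%O -> U = Csq 1 \/ (A <= U)%O.

Definition atom (A : SEM) : Prop := A <> Csq 1 /\ only A A.

Lemma onlyI (A V : SEM) :
    (forall (U : SEM) (S : semigroup) (x y : S), (U <= V)%O -> ~ (A <= U)%O ->
      members U S -> x = y) ->
  only A V.
Proof.
move=> H U UV; have [AU|nAU] := pselect (A <= U)%O; first by right.
by left; apply: eq_Csq1 => S x y US; apply: H US.
Qed.

Lemma only_le (A V W : SEM) : (V <= W)%O -> only A W -> only A V.
Proof. by move=> VW AW U UV; apply/AW/(le_trans UV). Qed.

Lemma atom_eq (A X : SEM) : atom A -> X <> Csq 1 -> (X <= A)%O -> X = A.
Proof.
by move=> [_ oA] X1 XA; have [//|AX] := oA X XA; apply: le_anti; rewrite XA AX.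
Qed.

Lemma Csq_identity k (V : SEM) i : (Csq k <= V)%O -> identities_of V i ->
  comm_theory (nonlinear_or_long k) i.
Proof.
move=> /SEM_leP kV Vi; apply/(identities_of_comm (zero_words_Csq k)) => S /kV.
exact: Vi.
Qed.

Lemma Csq_le k l : (k <= l)%N -> (Csq k <= Csq l)%O.
Proof.
move=> kl; apply: comm_theory_sub => s.
by case/orP=> [sU|/(leq_trans kl) sk]; apply/orP; [left|right].
Qed.

Lemma Csq_le_oo k : (Csq k <= Csq_oo)%O.
Proof. by apply: comm_theory_sub => s sU; apply/orP; left. Qed.

Lemma Csq_lt k l : (0 < k < l)%N -> ~ (Csq l <= Csq k)%O.
Proof.
case/andP=> k0 kl lk.
pose u := (0, iota 1 k.-1); pose v := (0, iota 1 k).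
have sv : size (letters v) = k.+1 by rewrite /= size_iota.
have su : letters u = iota 0 k by rewrite iota_letters.
have : identities_of (Csq k) (u, v).
  move=> S; apply; apply: comm_theory_zero; apply/orP; right.
    by rewrite su size_iota.
  by rewrite sv.
move=> /(Csq_identity lk)/orP[/andP[]|/perm_size].
  by rewrite su /nonlinear_or_long iota_uniq size_iota /= leqNgt kl.
by rewrite su sv size_iota => /eqP; rewrite ltn_eqF.
Qed.

Lemma Csq2_not_le (V : SEM) m :
    (forall (S : semigroup) (x : S), members V S -> x = pw x m.+1) ->
  ~ (Csq 2 <= V)%O.
Proof.
move=> Vm C2; have : identities_of V ((0, [::]), (0, nseq m.+1 0)).
  by move=> S VS f; rewrite word_val_nseq -Vm.
by move=> /(Csq_identity C2) /orP[//|/perm_size].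
Qed.

(** In a subvariety not containing [Csq 2], every element is one of its own higher
    powers; but in [Csq_oo] all the products with a repeated factor are equal. *)
Lemma only_Csq_oo : only (Csq 2) Csq_oo.
Proof.
apply: onlyI => U S x y Uoo /not_le_Csq2[m mE] US.
rewrite [x](mE S _ US) [y](mE S _ US).
have := members_sub Uoo US; move=> /(_ ((0, nseq m.+1 0), (1, nseq m.+1 1)) isT).
move=> /(_ (fun a => if a is 0 then x else y)).
by rewrite !word_val_nseq.
Qed.

Lemma Csq2_neq1 : Csq 2 <> Csq 1.
Proof. by move=> E; apply: (@Csq_lt 1 2) => //; rewrite E. Qed.

Lemma atom_Csq2 : atom (Csq 2).
Proof. by split; [exact: Csq2_neq1|exact: only_le (Csq_le_oo 2) only_Csq_oo]. Qed.

Lemma SL_neq1 : SL <> Csq 1.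
Proof.
by apply: (@neq_Csq1 (bool_semigroup andbA) true false) => //; apply: var_self.
Qed.

Lemma SL_members (S : semigroup) : members SL S ->
  (forall x : S, x * x = x)%sg /\ commutative_sg S.
Proof.
move=> SS; split; last exact: le_COM SL_le_COM SS.
move=> x; apply: (@var_satisfies _ _ ((0, [:: 0]), (0, [::])) _ SS (fun=> x)).
by move=> f; apply: andbb.
Qed.

Lemma atom_SL : atom SL.
Proof.
split; first exact: SL_neq1.
apply: onlyI => U S x y USL nSL US.
have [xx xy] := SL_members (members_sub USL US).
have le (z t : S) : z = (z * t)%sg.
  apply: (not_le_SL US nSL); rewrite ?xx //; first by rewrite smulA xx.
  by rewrite (xy (z * t)%sg) smulA xx.
by rewrite [LHS](le x y) xy -le.
Qed.

Lemma Csq2_not_le_SL : ~ (Csq 2 <= SL)%O.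
Proof. by apply: (@Csq2_not_le _ 0) => S x /SL_members[xx _]; rewrite pwSl xx. Qed.

Lemma Zv_neq1 n : (1 < n)%N -> Zv n <> Csq 1.
Proof.
case: n => [//|n] n0; apply: (@neq_Csq1 (cyclic n) (residue n 0) (residue n 1)).
  exact: var_self.
by move=> /eq_residue/eqP; rewrite eq_sym eqn_mod_dvd // dvdn1; case: (n) n0.
Qed.

Lemma Zv_members n (S : semigroup) (x y : S) :
  members (Zv n) S -> (pw x n.-1 * y)%sg = y.
Proof.
move=> /(@var_satisfies _ _ ((0, nseq n.-1 0 ++ [:: 1]), (1, [::]))).
move=> /(_ _ (fun a => if a is 0 then x else y)).
have val (T : semigroup) (f : nat -> T) :
    word_val f (0, nseq n.-1 0 ++ [:: 1]) = (pw (f 0) n.-1 * f 1)%sg.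
  by rewrite -word_val_nseq /word_val map_cat sprod_cat.
by rewrite /= val; apply=> f; rewrite /= val; apply: cyclic_identity.
Qed.

(** A subvariety of [Zv (p ^ j)] not containing [Zv p] satisfies an equality of powers
    whose exponents differ by a number prime to [p], so that its groups are trivial. *)
Lemma only_Zv p j : prime p -> only (Zv p) (Zv (p ^ j)).
Proof.
move=> pp; set n := (p ^ j)%N; have n0 : (0 < n)%N by rewrite expn_gt0 prime_gt0.
apply: onlyI => U S x y UZ /(not_le_Zv (prime_gt0 pp))[a [b [ab abE]]] US.
wlog ab_lt : a b ab abE / (a < b)%N.
  move=> H; have [/H|/H|abE'] := ltngtP a b; first by apply.
    by apply=> [|T z VT]; [exact: nesym|rewrite abE].
  by rewrite abE' in ab.
have SZ := members_sub UZ US; have SC := le_COM (Zv_le_COM n) SZ.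
have co : gcdn n (b - a) = 1.
  apply/eqP; rewrite -/(coprime _ _) coprimeXl // prime_coprime //.
  by rewrite -eqn_mod_dvd ?(ltnW ab_lt) //; apply/eqP => /esym.
have idem (z : S) : (z * z)%sg = z.
  have zn : pw z 0 = pw z (0 + n).
    by rewrite add0n -(prednK n0) pwSr (Zv_members _ _ SZ).
  have : pw z (n * a) = pw z (n * a + gcdn n (b - a)).
    apply: (pw_gcd n0 zn (b := a)); rewrite ?leq_pmull //.
    by rewrite subnKC ?(ltnW ab_lt) // abE.
  rewrite co addn1 => E; rewrite -[RHS]/(pw z 0) -[LHS]/(pw z 1).
  by rewrite (pw_period a zn (leqnn 0)) (pw_period a zn (leq0n 1)) add1n add0n.
have left_id (z t : S) : (z * t)%sg = t.
  rewrite -[RHS](Zv_members z t SZ); congr (_ * _)%sg.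
  by elim: (n.-1) => // i IH; rewrite pwSl -IH idem.
by rewrite -(left_id y x) SC left_id.
Qed.

Lemma atom_Zv p : prime p -> atom (Zv p).
Proof.
by move=> pp; split; [exact/Zv_neq1/prime_gt1|have := @only_Zv p 1 pp; rewrite expn1].
Qed.

Lemma Zv_dvdn p q : (0 < p)%N -> (0 < q)%N -> (Zv p <= Zv q)%O -> (p %| q)%N.
Proof.
case: p q => [//|p] [//|q] _ _ /SEM_leP/(_ _ (@var_self _)) /= pq.
have := @Zv_members q.+1 (cyclic p) (residue p 0) (residue p 0) pq.
rewrite residue_pw -residueM => /eq_residue/eqP.
by rewrite /= addn0 -[q.+2]addn1 -[X in _ == X %[mod _]]add0n eqn_modDr mod0n.
Qed.

(** * The variety of commutative semigroups *)

(** This is a lattice-theoretic property shared by [COM], which omits only the two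
    atoms [LZ] and [RZ]. *)
Definition almost_all_atoms (V : SEM) : Prop :=
  exists A1 A2, forall B, atom B -> [\/ B = A1, B = A2 | (B <= V)%O].

Lemma COM_almost_all_atoms : almost_all_atoms COM.
Proof.
exists LZ, RZ => B Batom; have [B1 _] := Batom.
have [BC|nBC] := pselect (B <= COM)%O; first by constructor 3.
have out X : X <> Csq 1 -> (X <= COM)%O -> ~ (X <= B)%O.
  by move=> X1 XC /(atom_eq Batom X1) XB; rewrite XB in XC.
have n1 := out _ Csq2_neq1 (@le_of_comm _).
have n2 := out _ SL_neq1 SL_le_COM.
have n3 p : prime p -> ~ (Zv p <= B)%O.
  by move=> pp; apply: out (Zv_le_COM p); apply/Zv_neq1/prime_gt1.
have [LZB|RZB] := atoms_below B1 n1 n2 n3.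
- constructor 1; apply/esym/(atom_eq Batom) => //.
  by apply: (@neq_Csq1 (bool_semigroup left_zeroA) true false) => //; apply: var_self.
- constructor 2; apply/esym/(atom_eq Batom) => //.
  by apply: (@neq_Csq1 (bool_semigroup right_zeroA) true false) => //; apply: var_self.
Qed.

(** A variety not containing [COM] is periodic, and so contains only finitely many
    of the varieties of abelian groups of prime exponent. *)
Lemma COM_least (V : SEM) : almost_all_atoms V -> (COM <= V)%O.
Proof.
move=> [A1 [A2 A12]]; apply: contrapT => /COM_periodic[a [d [d0 ad]]].
have nZ p : prime p -> (d < p)%N -> Zv p = A1 \/ Zv p = A2.
  move=> pp dp; have [->|->|] := A12 _ (atom_Zv pp); [by left|by right|].
  move=> /SEM_leP/(_ _ (@var_self _)).
  case: p pp dp => // p pp dp /(ad _ (residue p 0)).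
  rewrite !residue_pw => /eq_residue/eqP.
  rewrite -addSn eq_sym eqn_mod_dvd ?leq_addr // addKn.
  by move=> /(dvdn_leq d0); rewrite leqNgt dp.
have Zneq p q : prime p -> prime q -> (p < q)%N -> Zv p <> Zv q.
  move=> pp pq pltq E; have : (Zv q <= Zv p)%O by rewrite E.
  move=> /(Zv_dvdn (prime_gt0 pq) (prime_gt0 pp))/(dvdn_leq (prime_gt0 pp)).
  by rewrite leqNgt pltq.
have [p dp pp] := prime_above d; have [q pq qp] := prime_above p.
have [r qr rp] := prime_above q.
have := nZ _ pp dp; have := nZ _ qp (ltn_trans dp pq).
have := nZ _ rp (ltn_trans dp (ltn_trans pq qr)).
have := Zneq _ _ pp qp pq; have := Zneq _ _ qp rp qr.
have := Zneq _ _ pp rp (ltn_trans pq qr).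
by move=> n1 n2 n3 [] E1 [] E2 [] E3; rewrite E1 E2 E3 in n1 n2 n3.
Qed.

(** * Zero multiplication and semilattices *)

(** This relation singles out the pair consisting of [Csq 2] and [SL]: within [COM],
    the varieties not containing [Csq 2] are joins of groups and semilattices. *)
Definition splits_off (A B : SEM) : Prop :=
  [/\ atom A, atom B, (A <= COM)%O, (B <= COM)%O & A <> B] /\
  forall V : SEM, (V <= COM)%O -> ~ (A <= V)%O -> (B <= V)%O ->
    exists U : SEM, ~ (B <= U)%O /\ V = (U `|` B)%O.

(** The only subvariety of such a [V] not containing [B] is the trivial one, which does
    not yield [V] when joined with [B]. *)
Lemma not_splits_off (A B V : SEM) : only B V -> (V <= COM)%O -> (B <= V)%O ->
  ~ (V <= B)%O -> ~ splits_off A B.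
Proof.
move=> oB VC BV nVB [[[A1 oA] [B1 _] _ _ AB] split].
have nAV : ~ (A <= V)%O.
  move=> AV; have [//|BA] := oB _ AV; have [//|AB'] := oA _ BA.
  by apply: AB; apply: le_anti; rewrite AB' BA.
have [U [nBU VU]] := split V VC nAV BV.
have UV : (U <= V)%O by rewrite VU leUl.
have [U1|//] := oB _ UV.
by apply: nVB; rewrite VU U1 leUx Csq1_le lexx.
Qed.

Lemma not_splits_off_Csq2 A : ~ splits_off A (Csq 2).
Proof.
apply: (@not_splits_off A _ (Csq 3)); last exact: Csq_lt.
- exact: only_le (Csq_le_oo 3) only_Csq_oo.
- exact: le_of_comm.
- exact: Csq_le.
Qed.

Lemma not_splits_off_Zv A p : prime p -> ~ splits_off A (Zv p).
Proof.
move=> pp; have o2 := @only_Zv p 2 pp.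
have pp1 : (1 < p ^ 2)%N by rewrite -(exp1n 2) ltn_exp2r // prime_gt1.
apply: (not_splits_off o2).
- exact: Zv_le_COM.
- by have [/(Zv_neq1 pp1)|] := o2 _ (lexx _).
- move=> /(Zv_dvdn (ltnW pp1) (prime_gt0 pp))/(dvdn_leq (prime_gt0 pp)).
  by rewrite leqNgt -{1}[p]expn1 ltn_exp2l ?prime_gt1.
Qed.

(** The commutative monoid [{1, a, 0}] with [a^2 = 0]. *)
Inductive N1_type := N1_1 | N1_a | N1_0.

Definition N1 : semigroup.
Proof.
refine (@Defs.Semigroup N1_type (fun x y => match x, y with
  | N1_1, _ => y | _, N1_1 => x | _, _ => N1_0 end) _ (inhabits N1_0)).
by case=> [] [] [].
Defined.

(** If [var N1] were the join of [SL] and of [U] not containing [SL], then [U] would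
    satisfy [x^2 = y^2], and both would satisfy [x^2 y = x y^2], which fails in
    [N1]. *)
Lemma not_splits_off_Zv_SL p : prime p -> ~ splits_off (Zv p) SL.
Proof.
move=> pp [_ split]; have [] := split (var N1).
- by apply: var_le_COM => -[] [].
- move=> /SEM_leP/(_ _ (@var_self _)); case: p pp split => // p pp _.
  move=> /(@var_satisfies _ _ ((0, nseq 1 0), (0, nseq 2 0))) E.
  have /E/(_ (fun=> residue p 0)) : satisfies N1 ((0, nseq 1 0), (0, nseq 2 0)).
    by move=> f; rewrite /word_val /=; case: (f 0).
  rewrite !word_val_nseq !residue_pw => /eq_residue/eqP.
  by rewrite eq_sym eqn_mod_dvd // dvdn1 => /eqP[p0]; rewrite p0 in pp.
- apply/var_le => i N1i f.
  pose h (b : bool) : N1 := if b then N1_1 else N1_0.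
  have hM : {morph (h : bool_semigroup andbA -> N1) : b c / (b * c)%sg}.
    by case=> [] [].
  have := N1i N1 erefl (h \o f); rewrite -!(hom_word_val _ _ hM).
  by case: (word_val f i.1) (word_val f i.2) => [] [].
move=> U [nSL VU].
have N1_sq : satisfies N1 ((0, [:: 0]), (0, [:: 0; 0])).
  by move=> f; rewrite /word_val /=; case: (f 0).
have UN : (U <= var N1)%O by rewrite VU leUl.
have U_sq (S : semigroup) (x y : S) : members U S -> (x * x = y * y)%sg.
  move=> US; have SN := members_sub UN US.
  have S_comm : commutative_sg S.
    by apply: le_COM SN; apply: var_le_COM => -[] [].
  have cube (z : S) : (z * z = z * z * z)%sg.
    exact: (var_satisfies N1_sq SN (fun=> z)).
  have idem (z : S) : (z * z * (z * z) = z * z)%sg.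
    by rewrite smulA -!cube.
  have half (E F : S) : (E * E = E -> F * F = F -> E = E * F)%sg.
    move=> EE FF; apply: (not_le_SL US nSL) => //.
    + by rewrite smulA -(smulA E F E) (S_comm F E) smulA EE -smulA FF.
    + by rewrite smulA EE.
    + by rewrite S_comm smulA EE.
  by rewrite (half _ _ (idem x) (idem y)) S_comm -half.
have join_id : identities_of (var N1) ((0, [:: 0; 1]), (0, [:: 1; 1])).
  rewrite VU => S; apply; split=> T TU f; rewrite /word_val /=.
    have T_comm : commutative_sg T.
      by apply: le_COM (members_sub UN TU); apply: var_le_COM => -[] [].
    have cube (z : T) : (z * z = z * z * z)%sg.
      exact: (var_satisfies N1_sq (members_sub UN TU) (fun=> z)).
    rewrite (U_sq _ _ (f 1) TU) -cube -smulA (U_sq _ (f 1) (f 0) TU) smulA.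
    by rewrite -cube.
  have [xx xy] := SL_members TU; by rewrite xx -smulA xx.
by have := join_id N1 (@var_self _) (fun a => if a is 0 then N1_1 else N1_a).
Qed.

Lemma sval_inj (T : Type) (P : T -> Prop) (x y : {x : T | P x}) :
  sval x = sval y -> x = y.
Proof. by case: x y => [x Px] [y Py] /= xy; apply: eq_exist. Qed.

Section Subsemigroup.
Variables (S : semigroup) (P : S -> Prop).
Hypothesis PM : forall x y : S, P x -> P y -> P (x * y)%sg.
Hypothesis P_nonempty : exists x, P x.

Definition subsemigroup : semigroup.
Proof.
pose mul (x y : {x : S | P x}) : {x : S | P x} :=
  exist _ (sval x * sval y)%sg (PM (svalP x) (svalP y)).
refine (@Defs.Semigroup {x : S | P x} mul _ _).
  by move=> x y z; apply: sval_inj; rewrite /= smulA.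
by have [x Px] := P_nonempty; apply: (inhabits (exist _ x Px)).
Defined.

Lemma sval_word_val (f : nat -> subsemigroup) w :
  sval (word_val f w) = word_val (fun a => sval (f a)) w.
Proof. by rewrite (@hom_word_val subsemigroup S (fun x => sval x)). Qed.

Lemma subsemigroup_member (V : SEM) : members V S -> members V subsemigroup.
Proof.
move=> VS; apply/membersE => i Vi f; apply: sval_inj.
by rewrite !sval_word_val (Vi _ VS).
Qed.

End Subsemigroup.

Section Clifford.
Variable S : semigroup.
Hypothesis S_comm : commutative_sg S.
Local Open Scope semigroup_scope.

Lemma word_val_scale (e : S) f w : e * e = e ->
  word_val (fun a => e * f a) w = e * word_val f w.
Proof.
move=> ee; case: w => a s; rewrite /word_val /=.
elim: s (f a) => //= b s IH x.
by rewrite -IH; congr sprod; rewrite smulA -(smulA e x e) (S_comm x e) smulA ee smulA.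
Qed.

Lemma pw_mul (x y : S) n : pw (x * y) n = pw x n * pw y n.
Proof.
elim: n => // n IH; rewrite !pwSl IH -!smulA; congr (_ * _).
by rewrite !smulA (S_comm y).
Qed.

Lemma word_val_absorb (e : nat -> S) w a : (forall b, e b * e b = e b) ->
  a \in letters w -> word_val e w * e a = word_val e w.
Proof.
move=> ee; case: w => b s; rewrite /word_val /letters inE /=.
have abs x t : x * e a = x -> sprod x (map e t) * e a = sprod x (map e t).
  elim: t x => //= c t IH x xa; apply: IH.
  by rewrite -smulA (S_comm _ (e a)) smulA xa.
case/predU1P=> [<-|/splitPr[s1 s2]]; first exact: abs.
by rewrite map_cat sprod_cat /=; apply: abs; rewrite -smulA ee.
Qed.

(** Each of the two products absorbs the factors of the other. *)
Lemma idempotent_word_val (e : nat -> S) u v : (forall b, e b * e b = e b) ->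
  letters u =i letters v -> word_val e u = word_val e v.
Proof.
move=> ee uv; have abs w w' : {subset letters w' <= letters w} ->
    word_val e w * word_val e w' = word_val e w.
  move=> ww'; rewrite -word_valE; elim: (letters w') ww' => // a s IH ww' /=.
  rewrite word_val_absorb ?ww' ?mem_head // IH // => b bs.
  by rewrite ww' // inE bs orbT.
rewrite -[LHS](abs _ v) => [|a]; last by rewrite uv.
by rewrite S_comm abs // => a; rewrite uv.
Qed.

End Clifford.

Lemma SL_content u v : satisfies (bool_semigroup andbA) (u, v) ->
  letters u =i letters v.
Proof.
have val a w : @word_val (bool_semigroup andbA) (fun b => b != a) w =
    (a \notin letters w).
  case: w => b s; rewrite /word_val /letters inE /= negb_or eq_sym.
  elim: s (a != b) => [|c s IH] x /=; first by rewrite andbT.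
  by rewrite IH inE negb_or [a == c]eq_sym andbA.
by move=> uv a; apply: negb_inj; rewrite -!val (uv (fun b => b != a)).
Qed.

(** A commutative variety of unions of groups is the join of its groups and of the
    semilattices: if both sides of an identity have the same letters, then their
    values for given elements lie in one subgroup, with identity element [e] say,
    and are not altered if the elements are multiplied by [e], which moves them
    into this subgroup. *)
Lemma splits_off_Csq2_SL : splits_off (Csq 2) SL.
Proof.
split; first split.
- exact: atom_Csq2.
- exact: atom_SL.
- exact: le_of_comm.
- exact: SL_le_COM.
- by move=> E; apply: Csq2_not_le_SL; rewrite E.
move=> V VC /not_le_Csq2[m mE] SLV.
pose one : identity := ((0, nseq m 0 ++ [:: 1]), (1, [::])).
have oneE (S : semigroup) : satisfies S one <-> forall x y : S, (pw x m * y)%sg = y.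
  have val (f : nat -> S) : word_val f one.1 = (pw (f 0) m * f 1)%sg.
    by rewrite -word_val_nseq /word_val map_cat sprod_cat.
  split=> [S1 x y|xy f]; last by rewrite val xy.
  by have := S1 (fun a => if a is 0 then x else y); rewrite val.
exists (V `&` models_variety [set one])%O; split.
  move=> /SEM_leP/(_ _ (@var_self _))/members_meet[_ /(_ one erefl)/oneE].
  by move=> /(_ false true); elim: (m).
apply: le_anti; rewrite leUx leIl SLV /= andbT; apply/SEM_leP => S VS.
apply/members_join => -[u v] Uuv SLuv f /=.
have S_comm := le_COM VC VS.
have xm (x : S) : x = pw x m.+1 by apply: mE.
pose e a := pw (f a) m; pose c := word_val e u.
have ee a : (e a * e a = e a)%sg by have [] := pw_unit (xm (f a)).
have uv : letters u =i letters v by apply: SL_content; apply: SLuv; apply: var_self.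
have cv : c = word_val e v by apply: idempotent_word_val.
have pwc w : word_val e w = pw (word_val f w) m.
  by rewrite (@hom_word_val S S (fun x => pw x m)) // => x y; apply: pw_mul.
have cc : (c * c = c)%sg by rewrite /c pwc; have [] := pw_unit (xm (word_val f u)).
have pwcm : pw c m = c by elim: (m) => // n IH; rewrite pwSl IH.
pose P x := pw x m = c.
have PM (x y : S) : P x -> P y -> P (x * y)%sg by rewrite /P pw_mul // => -> ->.
have Pf a : P (if a \in letters u then c * f a else c)%sg.
  rewrite /P; case: ifP => // au; rewrite pw_mul // pwcm.
  exact: word_val_absorb.
pose T := subsemigroup PM (ex_intro _ _ (Pf 0)).
have TU : members (V `&` models_variety [set one])%O T.
  apply/members_meet; split; first exact: subsemigroup_member.
  move=> _ ->; apply/oneE => x y; apply: sval_inj => /=.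
  have -> : sval (pw x m) = pw (sval x) m.
    by rewrite -(@word_val_nseq T (fun=> x) 0 m) sval_word_val word_val_nseq.
  by rewrite (svalP x) -{1}(svalP y) -pwSr -xm.
pose g a : T := exist _ _ (Pf a).
have /(congr1 (fun x => sval x)) := Uuv _ TU g.
rewrite /= !sval_word_val /=.
have gE w : letters w =i letters u -> c = pw (word_val f w) m ->
    word_val (fun a => if a \in letters u then (c * f a)%sg else c) w = word_val f w.
  move=> wu cw; rewrite -[RHS](_ : c * word_val f w = word_val f w)%sg.
    by rewrite -word_val_scale //; apply: eq_word_val => a; rewrite wu => ->.
  by rewrite cw -pwSr -xm.
by rewrite !gE // -?pwc.
Qed.

Lemma splits_offE A B : splits_off A B <-> A = Csq 2 /\ B = SL.
Proof.
split=> [AB|[-> ->]]; last exact: splits_off_Csq2_SL.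
have [[Aatom Batom AC BC AnB] _] := AB.
have commutative_atom X : atom X -> (X <= COM)%O ->
    [\/ X = Csq 2, X = SL | exists2 p, prime p & X = Zv p].
  move=> Xatom XC; apply: contrapT => nX.
  have [X1 _] := Xatom.
  have out Y : X <> Y -> Y <> Csq 1 -> ~ (Y <= X)%O.
    by move=> XY Y1 /(atom_eq Xatom Y1)/esym.
  have n1 : ~ (Csq 2 <= X)%O.
    by apply: out Csq2_neq1 => E; apply: nX; constructor 1.
  have n2 : ~ (SL <= X)%O by apply: out SL_neq1 => E; apply: nX; constructor 2.
  have n3 p : prime p -> ~ (Zv p <= X)%O.
    move=> pp; apply: out; last exact/Zv_neq1/prime_gt1.
    by move=> E; apply: nX; constructor 3; exists p.
  have [|] := atoms_below X1 n1 n2 n3 => /le_trans/(_ XC)/var_le/members_COM.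
    by move=> /(_ true false).
  by move=> /(_ true false).
have [BE|BE|[p pp BE]] := commutative_atom B Batom BC; rewrite BE in AB AnB *.
- by have := not_splits_off_Csq2 AB.
- have [AE|AE|[p pp AE]] := commutative_atom A Aatom AC; rewrite AE in AB AnB *.
  + by [].
  + by [].
  + by have := not_splits_off_Zv_SL pp AB.
- by have := not_splits_off_Zv pp AB.
Qed.

(** * Commutative nil varieties *)

(** By the classification of atoms, these are the varieties of commutative nil
    semigroups. *)
Definition comm_nil (V : SEM) : Prop := (V <= COM)%O /\ only (Csq 2) V.

Lemma comm_nil_le (U V : SEM) : (U <= V)%O -> comm_nil V -> comm_nil U.
Proof. by move=> UV [VC V2]; split; [exact: le_trans VC|exact: only_le V2]. Qed.

Definition is_zero (S : semigroup) (z : S) : Prop :=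
  forall y : S, (z * y)%sg = z /\ (y * z)%sg = z.

Lemma nil_product (S : semigroup) (z : S) u v : is_zero z ->
    (forall x : S, exists n, pw x n = z) -> satisfies S (u, v) ->
    uniq (letters u) -> ~~ perm_eq (letters u) (letters v) ->
  forall x, spower (size (letters u)) x -> x = z.
Proof.
move=> zz nil uv uU nuv; apply: (nil_ideal_power (v := v)) => // x y ->.
  by have [] := zz x.
by have [] := zz y.
Qed.

(** Excluding the groups makes the varieties aperiodic; excluding the semilattices makes
    the idempotents equal. *)
Lemma comm_nil_zero (V : SEM) : comm_nil V -> exists N,
  forall (S : semigroup) (x : S), members V S ->
    is_zero (pw x N) /\ forall y : S, pw y N = pw x N.
Proof.
move=> [VC V2].
have nSL : ~ (SL <= V)%O by move=> /V2[/SL_neq1|/Csq2_not_le_SL].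
have nZ p : prime p -> ~ (Zv p <= V)%O.
  move=> pp /V2[/Zv_neq1|]; first by apply; apply: prime_gt1.
  by apply: (@Csq2_not_le _ p.-1) => S x Sp; rewrite pwSr (Zv_members _ _ Sp).
have nC : ~ (COM <= V)%O by move=> /(le_trans SL_le_COM).
have [N NE] := aperiodic nC nZ; exists N => S x VS.
have S_comm := le_COM VC VS.
have idem (y : S) : (pw y N * pw y N)%sg = pw y N.
  rewrite pwD -addnS; elim: (N.+1) => [|n IH]; first by rewrite addn0.
  by rewrite addnS -addSn -IH (pw_add n (NE _ _ VS)).
have half (E F : S) : (E * E = E -> F * F = F -> E = E * F)%sg.
  move=> EE FF; apply: (not_le_SL VS nSL) => //.
  + by rewrite smulA -(smulA E F E) (S_comm F E) smulA EE -smulA FF.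
  + by rewrite smulA EE.
  + by rewrite S_comm smulA EE.
have const (y : S) : pw y N = pw x N.
  by rewrite (half _ _ (idem x) (idem y)) S_comm -half.
split=> // y; rewrite (S_comm y).
by rewrite -(const y) -pwSr -(NE _ _ VS).
Qed.

Lemma nonlinear_zero (S : semigroup) (z : S) f w : commutative_sg S -> is_zero z ->
  (forall x : S, x * x = z)%sg -> ~~ uniq (letters w) -> word_val f w = z.
Proof.
move=> S_comm zz sq; case: w => a s nU.
have zprod t : sprod z t = z by elim: t => //= y t; have [-> _] := zz y.
have {nU} [b [t st]] : exists b t, perm_eq (letters (a, s)) (letters (b, b :: t)).
  elim: (letters (a, s)) nU => //= c t IH; rewrite negb_and negbK.
  case/orP=> [/splitPr[t1 t2]|/IH[b [t' tt']]].
    exists c, (t1 ++ t2); rewrite /= perm_cons.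
    exact: permEl (perm_catCA t1 [:: c] t2).
  exists b, (c :: t'); rewrite -(perm_cons c) in tt'.
  apply: perm_trans tt' _; exact: permEl (perm_catCA [:: c] [:: b; b] t').
by rewrite (perm_word_val S_comm f st) /word_val /= sq zprod.
Qed.

Lemma le_comm_theory (Z : pred (seq nat)) (V : SEM) : (V <= COM)%O ->
    (forall S : semigroup, members V S -> exists z : S,
      forall f w, Z (letters w) -> word_val f w = z) ->
  (V <= models_variety (comm_theory Z))%O.
Proof.
move=> VC VZ; apply/SEM_leP => S VS [u v] /orP[/andP[Zu Zv]|uv] f.
  by have [z zE] := VZ S VS; rewrite !zE.
exact: (perm_word_val (le_COM VC VS)).
Qed.

Lemma Csq_oo_zero (S : semigroup) (x : S) : members Csq_oo S ->
  is_zero (x * x)%sg /\ forall y : S, (y * y = x * x)%sg.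
Proof.
move=> Soo; have S_comm := le_COM (@le_of_comm _) Soo.
split=> y.
  rewrite (S_comm y).
  by have := Soo ((0, [:: 0; 1]), (0, [:: 0])) isT (fun a => if a is 0 then x else y).
by have := Soo ((1, [:: 1]), (0, [:: 0])) isT (fun a => if a is 0 then x else y).
Qed.

Lemma spower_word_le (S : semigroup) (f : nat -> S) w k :
  (0 < k <= size (letters w))%N -> spower k (word_val f w).
Proof. by move=> kw; apply: spower_le (spower_word_val f w). Qed.

Lemma sub_Csq_oo (U : SEM) k : (U <= Csq_oo)%O -> ~ (Csq k.+1 <= U)%O -> (U <= Csq k)%O.
Proof.
move=> Uoo /not_le_Csq[u [v [Uuv uU uk nuv]]].
apply: le_comm_theory => [|S US]; first exact: le_trans Uoo (@le_of_comm _).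
have Soo := members_sub Uoo US; have S_comm := le_COM (@le_of_comm _) Soo.
have [x] := semigroup_nonempty S; have [zz sq] := Csq_oo_zero x Soo.
exists (x * x)%sg => f w /orP[wU|kw]; first exact: nonlinear_zero.
apply: (nil_product zz _ (Uuv _ US) uU nuv) => [y|].
  by exists 1; apply: sq.
by apply: spower_word_le => /=; apply: leq_trans kw.
Qed.

Lemma Csq_oo_sup (U : SEM) : (forall k, Csq k.+1 <= U)%O -> (Csq_oo <= U)%O.
Proof.
move=> kU; apply: contrapT => /not_le_comm[u [v [Uuv uU nuv]]].
have /orP[/andP[]|] := Csq_identity (kU (size (letters u))) Uuv.
  by rewrite /nonlinear_or_long (negPf uU) ltnn.
by rewrite (negPf nuv).
Qed.

(** The subvarieties of [Csq_oo] are itself and the varieties [Csq k]. *)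
Lemma Csq_oo_chain (U W : SEM) : (U <= Csq_oo)%O -> (W <= Csq_oo)%O ->
  (U <= W)%O \/ (W <= U)%O.
Proof.
move=> Uoo Woo.
have [[k [kU kW]]|nk] := pselect (exists k, ~ (Csq k.+1 <= U)%O /\ (Csq k.+1 <= W)%O).
  left; apply: le_trans (sub_Csq_oo Uoo kU) (le_trans _ kW).
  exact/Csq_le/leqnSn.
have WU k : (Csq k.+1 <= W)%O -> (Csq k.+1 <= U)%O.
  by move=> kW; apply: contrapT => kU; apply: nk; exists k.
right; have [kU|/existsNP[k kU]] := pselect (forall k, Csq k.+1 <= U)%O.
  exact/(le_trans Woo)/Csq_oo_sup.
have exW : exists k, ~~ (Csq k.+1 <= W)%O.
  by exists k; apply/negP => /WU.
case: (ex_minnP exW) => -[|j] /negP jW jmin; first by case: jW; apply: Csq1_le.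
apply: (le_trans (sub_Csq_oo Woo jW)); apply: WU.
by apply: contraT => /jmin; rewrite ltnn.
Qed.

(** The variety of commutative semigroups satisfying [x y z = 0]. *)
Definition A3 : SEM := models_variety (comm_theory (fun s => (2 < size s)%N)).

Lemma A3_not_le_oo : ~ (A3 <= Csq_oo)%O.
Proof.
move=> /SEM_leP Aoo.
have : identities_of A3 ((0, [:: 0]), (0, [:: 0; 0])).
  by move=> S /Aoo; apply.
by move=> /(identities_of_comm (zero_words_long 3)).
Qed.

Lemma Csq4_not_le_A3 : ~ (Csq 4 <= A3)%O.
Proof.
move=> C4; have : identities_of A3 ((0, [:: 1; 2]), (0, [:: 1; 2; 3])).
  by move=> S; apply.
by move=> /(Csq_identity C4).
Qed.

Lemma comm_nil_le_A3 (V : SEM) : comm_nil V -> ~ (Csq 4 <= V)%O -> (V <= A3)%O.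
Proof.
move=> Vnil /not_le_Csq[u [v [Vuv uU uk nuv]]]; have [VC _] := Vnil.
have [N NE] := comm_nil_zero Vnil.
apply: le_comm_theory => // S VS; have [x] := semigroup_nonempty S.
have [zz const] := NE S x VS; exists (pw x N) => f w w3.
apply: (nil_product zz _ (Vuv _ VS) uU nuv) => [y|]; first by exists N.
by apply: spower_word_le => /=; apply: leq_trans w3.
Qed.

Lemma perm_small (s t : seq nat) : (size s <= 2)%N -> size s = size t ->
  s =i t -> perm_eq s t.
Proof.
move=> s2 st sti; have [sU|] := boolP (uniq s).
  by apply: uniq_perm => //; rewrite (uniq_size_uniq sU sti) st.
case: s s2 st sti => [|a [|b [|//]]] //= _; rewrite andbT inE negbK.
case: t => [|c [|d [|//]]] // _ sti /eqP ab.
have in_s e : e \in [:: c; d] -> e = a by rewrite -sti !inE ab orbb => /eqP.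
have ca : c = a by apply: in_s; rewrite mem_head.
have da : d = a by apply: in_s; rewrite !inE eqxx orbT.
by rewrite ca da -ab.
Qed.

(** An identity [u = v] failing in [A3] has a side [u] of length at most 2. If the
    lengths differ, some power of [x] up to [x^2] equals a higher one, hence zero;
    otherwise some letter occurs on one side only, and is given the value zero. *)
Lemma comm_nil_le_oo (V : SEM) : comm_nil V -> ~ (A3 <= V)%O -> (V <= Csq_oo)%O.
Proof.
move=> Vnil /not_le_comm[u [v [Vuv u2 nuv]]]; have [VC _] := Vnil.
have [N NE] := comm_nil_zero Vnil.
apply: le_comm_theory => // S VS; have [x0] := semigroup_nonempty S.
have S_comm := le_COM VC VS.
have [zz const] := NE S x0 VS; exists (pw x0 N) => f w wU.
suff sq (x : S) : (x * x)%sg = pw x0 N by apply: nonlinear_zero.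
move: x => {w f wU} x.
set z := pw x0 N in zz const *.
have big M : (N <= M)%N -> pw x M = z.
  move=> /subnK<-; elim: (M - N)%N => [|m IH]; first exact: const.
  by rewrite addSn pwSl IH; have [_] := zz x.
have low a : (a <= 1)%N -> pw x a = z -> (x * x)%sg = z.
  case: a => [|[|//]] _ E; last by rewrite -[RHS]E.
  by rewrite -[x in LHS]/(pw x 0) E; have [] := zz z.
have per a b : (a <= 1)%N -> (a < b)%N -> pw x a = pw x b -> (x * x)%sg = z.
  move=> a1 ab abE; apply: (low a) => //.
  rewrite (@pw_period _ x a (b - a) a N) ?subnKC ?(ltnW ab) // big //.
  by rewrite (leq_trans (leq_pmull _ _) (leq_addl _ _)) // subn_gt0.
have uvx : pw x (size u.2) = pw x (size v.2).
  by rewrite -!(word_val_const x) (Vuv S VS).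
have u1 : (size u.2 <= 1)%N by rewrite -leqNgt in u2.
have [uv|vu|uv] := ltngtP (size u.2) (size v.2).
- exact: (per _ _ u1 uv uvx).
- exact: (per _ _ (leq_trans (ltnW vu) u1) vu (esym uvx)).
have sep w w' b : b \in letters w -> b \notin letters w' ->
    (forall g : nat -> S, word_val g w = word_val g w') -> pw x (size w'.2) = z.
  move=> bw bw' ww'; pose g c := if c == b then z else x.
  have <- : word_val g w' = pw x (size w'.2).
    rewrite -word_val_const; apply: eq_word_val => c cw'; rewrite /g.
    by case: eqP cw' bw' => // -> ->.
  rewrite -ww'; apply: (@ideal_word_val S (fun y => y = z) _ w b) => //.
  - by move=> y _ ->; have [] := zz y.
  - by move=> _ y ->; have [] := zz y.
  - by rewrite /g eqxx.
have [/allPn[b bv bu]|vu] := boolP (~~ all (mem (letters u)) (letters v)).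
  by apply: low u1 (sep v u b bv bu _) => g; rewrite (Vuv S VS).
have [/allPn[b bu bv]|uv'] := boolP (~~ all (mem (letters v)) (letters u)).
  apply: (low (size v.2)); first by rewrite -uv.
  by apply: (sep u v b bu bv) => g; apply: Vuv.
move: vu uv'; rewrite !negbK => /allP vu /allP uv'; case/negP: nuv.
apply: perm_small; [exact: u1|by rewrite /= uv|].
by move=> a; apply/idP/idP => [/uv'|/vu].
Qed.

(** * The variety of commutative semigroups with zero squares *)

Definition sub_chain (V : SEM) : Prop :=
  forall U W : SEM, (U <= V)%O -> (W <= V)%O -> (U <= W)%O \/ (W <= U)%O.

(** The requirement of two varieties in between excludes [A3], the only variety with the
    first two properties that is not contained in [Csq_oo]. *)
Definition tall_chain (V : SEM) : Prop :=
  [/\ comm_nil V, sub_chain V &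
      exists U W : SEM, [/\ (Csq 2 < U)%O, (U < W)%O & (W < V)%O]].

Lemma SEM_ltP (V W : SEM) : (V < W)%O <-> (V <= W)%O /\ ~ (W <= V)%O.
Proof.
rewrite lt_def; split=> [/andP[/eqP nVW VW]|[VW nWV]].
  by split=> // WV; apply/nVW/le_anti; rewrite WV VW.
by rewrite VW andbT; apply/eqP => WV; apply: nWV; rewrite WV.
Qed.

Lemma Csq_oo_tall : tall_chain Csq_oo.
Proof.
split.
- by split; [exact: le_of_comm|exact: only_Csq_oo].
- exact: Csq_oo_chain.
exists (Csq 3), (Csq 4); split; apply/SEM_ltP; split.
- exact: Csq_le.
- exact: Csq_lt.
- exact: Csq_le.
- exact: Csq_lt.
- exact: Csq_le_oo.
- by move=> /(le_trans (Csq_le_oo 5)); apply: Csq_lt.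
Qed.

(** If [V] is not contained in [Csq_oo], it contains [A3]. Then it does not contain
    [Csq 4], which is incomparable with [A3], so that [V] is [A3]. But [Csq 3] is the
    only variety strictly between [Csq 2] and [A3]. *)
Lemma Csq_oo_greatest (V : SEM) : tall_chain V -> (V <= Csq_oo)%O.
Proof.
move=> [Vnil chain [U [W [U2 UW WV]]]]; apply: contrapT => nVoo.
have AV : (A3 <= V)%O by apply: contrapT => /(comm_nil_le_oo Vnil).
have nCV : ~ (Csq 4 <= V)%O.
  move=> CV; have [AC|] := chain _ _ AV CV; last exact: Csq4_not_le_A3.
  by apply: A3_not_le_oo; apply: le_trans AC (Csq_le_oo 4).
have VA := comm_nil_le_A3 Vnil nCV.
have WleV := ltW WV; have UleW := ltW UW.
have Woo : (W <= Csq_oo)%O.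
  apply: comm_nil_le_oo (comm_nil_le WleV Vnil) _ => AW.
  by have /SEM_ltP[_ []] := WV; apply: le_trans AW.
have W3 : (W <= Csq 3)%O.
  by apply: sub_Csq_oo => // CW; apply: nCV; apply: le_trans WleV.
have /SEM_ltP[_ []] := U2; apply: sub_Csq_oo; first exact: le_trans Woo.
by move=> CU; have /SEM_ltP[_ []] := UW; apply: le_trans CU.
Qed.

Lemma Csq_oo_unique (V : SEM) :
  tall_chain V /\ (forall W, tall_chain W -> (W <= V)%O) <-> V = Csq_oo.
Proof.
split=> [[Vtall Vmax]|->]; last by split; [exact: Csq_oo_tall|exact: Csq_oo_greatest].
by apply: le_anti; rewrite Csq_oo_greatest // Vmax //; apply: Csq_oo_tall.
Qed.

Lemma Csq_succ (V : SEM) k : (0 < k)%N -> V = Csq k.+1 <->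
  [/\ (V <= Csq_oo)%O, ~ (V <= Csq k)%O &
      forall W : SEM, (W <= Csq_oo)%O -> ~ (W <= Csq k)%O -> (V <= W)%O].
Proof.
move=> k0; have least W : (W <= Csq_oo)%O -> ~ (W <= Csq k)%O -> (Csq k.+1 <= W)%O.
  by move=> Woo nW; apply: contrapT => /(sub_Csq_oo Woo).
split=> [->|[Voo nV Vmin]].
  by split; [exact: Csq_le_oo|apply: Csq_lt; rewrite k0 /=|exact: least].
apply: le_anti; rewrite least // andbT; apply: Vmin (Csq_le_oo _) _.
by apply: Csq_lt; rewrite k0 /=.
Qed.

(** * Left and right identities *)

(** The first and the third conditions leave only [P3] and its dual as possible
    sources of noncommutativity. *)
Definition noncommutative_witness (W : SEM) : Prop :=
  [/\ ~ (Csq 3 <= W)%O, ~ (W <= COM)%O &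
      forall U : SEM, (U <= W)%O -> [\/ U = Csq 1, (Csq 2 <= U)%O | (SL <= U)%O]].

(** In a subvariety of [var Q] not containing [Csq 2], the equality of [x^2] and [x^3]
    makes every element idempotent; so the subvariety consists of semilattices. *)
Lemma witness_var (Q : semigroup) i : ~ commutative_sg Q ->
    (forall x : Q, x * x = x * x * x)%sg ->
    (forall x y : Q, x * x * (y * y) = y * y * (x * x))%sg ->
    satisfies Q i -> ~ comm_theory (nonlinear_or_long 3) i ->
  noncommutative_witness (var Q).
Proof.
move=> nQ cube squares Qi ni; split.
- by move=> C3; apply/ni/(Csq_identity C3) => S; apply=> _ ->.
- by move=> /le_COM/(_ (@var_self _)).
move=> U UQ; apply: contrapT => nU.
have nZM : ~ (Csq 2 <= U)%O by move=> ?; apply: nU; constructor 2.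
have nSL : ~ (SL <= U)%O by move=> ?; apply: nU; constructor 3.
apply: nU; constructor 1; apply: eq_Csq1 => S x y US.
have SQ := members_sub UQ US.
have cubeS (z : S) : (z * z = z * z * z)%sg.
  apply: (@var_satisfies Q S ((0, [:: 0]), (0, [:: 0; 0])) _ SQ (fun=> z)).
  by move=> f; apply: cube.
have band (z : S) : (z * z = z)%sg.
  have [m mE] := not_le_Csq2 nZM.
  have E n : pw z n.+1 = pw z 1.
    by elim: n => // n IH; rewrite pwSr IH; apply: esym (cubeS z).
  by rewrite [RHS](mE S z US) E.
have S_comm (z t : S) : (z * t = t * z)%sg.
  have := @var_satisfies Q S ((0, [:: 0; 1; 1]), (1, [:: 1; 0; 0])) _ SQ
    (fun a => if a is 0 then z else t).
  rewrite /word_val /= -!smulA !band !smulA ?band => -> // f.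
  by have := squares (f 0) (f 1); rewrite /word_val /= !smulA.
have le (z t : S) : z = (z * t)%sg.
  apply: (not_le_SL US nSL) => //; first by rewrite smulA band.
  by rewrite (S_comm (z * t)%sg) smulA band.
by rewrite [LHS](le x y) S_comm -le.
Qed.

Lemma P3_witness : noncommutative_witness (var P3).
Proof.
apply: (@witness_var P3 ((0, [:: 1]), (0, [:: 0; 1]))).
- by move=> /(_ P3e P3a).
- by case.
- by case=> [] [].
- by move=> f; rewrite /word_val /=; case: (f 0).
- by [].
Qed.

Lemma dual_P3_witness : noncommutative_witness (var (dual P3)).
Proof.
apply: (@witness_var (dual P3) ((0, [:: 1]), (0, [:: 1; 1]))).
- by move=> /(_ P3e P3a).
- by case.
- by case=> [] [].
- by move=> f; rewrite /word_val /=; case: (f 1).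
- by [].
Qed.

(** If neither [P3] nor its dual lies in a witness, then all the products of two
    elements are idempotent, and commute because there are neither left nor right
    zero semigroups; hence [x y] and [y x], which divide each other, are equal. *)
Lemma witnessP (V : SEM) :
  (exists2 W : SEM, (W <= V)%O & noncommutative_witness W) <->
  (var P3 <= V)%O \/ (var (dual P3) <= V)%O.
Proof.
split=> [[W WV [nC3 nCOM WU]]|[PV|PV]]; last first.
- by exists (var (dual P3)); last exact: dual_P3_witness.
- by exists (var P3); last exact: P3_witness.
apply: contrapT => nV.
have /not_var_le[[u1 v1] [f1 [W1 n1]]] : ~ (var P3 <= W)%O.
  by move=> PW; apply: nV; left; apply: le_trans WV.
have /not_var_le[[u2 v2] [f2 [W2 n2]]] : ~ (var (dual P3) <= W)%O.
  by move=> PW; apply: nV; right; apply: le_trans WV.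
have [u [v [Wuv uU uk nuv]]] := not_le_Csq nC3.
have nC : ~ (COM <= W)%O by move=> CW; apply/nC3/(le_trans _ CW)/le_of_comm.
have out m (X : SEM) : X <> Csq 1 ->
    (forall (S : semigroup) (x : S), members X S -> x = pw x m.+1) ->
    ~ (SL <= X)%O -> ~ (X <= W)%O.
  by move=> X1 Xm nSL /WU[//|/(Csq2_not_le Xm)|].
have nZ p : prime p -> ~ (Zv p <= W)%O.
  move=> pp; apply: (out p.-1); first exact/Zv_neq1/prime_gt1.
    by move=> S x Sp; rewrite pwSr (Zv_members _ _ Sp).
  move=> /SEM_leP/(_ _ (@var_self _)) SLp.
  have := @Zv_members p _ (false : bool_semigroup andbA) true SLp.
  by case: (p.-1) => // n; rewrite pwSl.
have [N NE] := aperiodic nC nZ.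
have nLZ : ~ (LZ <= W)%O.
  apply: (out 0).
  - apply: (@neq_Csq1 (bool_semigroup left_zeroA) true false) => //; exact: var_self.
  - move=> S x Sx.
    have xx : satisfies (bool_semigroup left_zeroA) ((0, [::]), (0, [:: 0])) by [].
    exact: (var_satisfies xx Sx (fun=> x)).
  - move=> /SEM_leP/(_ _ (@var_self _)) SLz.
    have LZi : satisfies (bool_semigroup left_zeroA) ((0, [::]), (0, [:: 1])) by [].
    by have := var_satisfies LZi SLz (fun a => a == 0).
have nRZ : ~ (RZ <= W)%O.
  apply: (out 0).
  - apply: (@neq_Csq1 (bool_semigroup right_zeroA) true false) => //; exact: var_self.
  - move=> S x Sx.
    have xx : satisfies (bool_semigroup right_zeroA) ((0, [::]), (0, [:: 0])) by [].
    exact: (var_satisfies xx Sx (fun=> x)).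
  - move=> /SEM_leP/(_ _ (@var_self _)) SLz.
    have RZi : satisfies (bool_semigroup right_zeroA) ((0, [::]), (1, [:: 0])) by [].
    by have := var_satisfies RZi SLz (fun a => a == 0).
apply: nCOM; apply/SEM_leP => S WS; apply/members_COM.
have product_idem (x y : S) : (x * y * (x * y) = x * y)%sg.
  have [|n xyn] := product_in_subgroup (Wuv _ WS) uU nuv
    (W1 _ WS) n1 (W2 _ WS) n2 (x := (x * y)%sg).
    by apply: (@spower_le _ _ 2); [apply: uk|exists x, [:: y]].
  exact: aperiodic_idempotent xyn (NE _ _ WS).
have idem_comm (e f : S) : (e * e = e -> f * f = f -> e * f = f * e)%sg.
  move=> ee ff.
  have ef : (e * f = e * f * e)%sg.
    apply: (not_le_RZ WS nRZ); rewrite ?product_idem //.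
      by rewrite smulA product_idem.
    by rewrite -(smulA _ e) (smulA e e) ee product_idem.
  have fe : (f * e = e * f * e)%sg.
    apply: (not_le_LZ WS nLZ); rewrite ?product_idem //.
      by rewrite -(smulA e) smulA -(smulA f e e) ee product_idem.
    by rewrite -(smulA e f e) -smulA product_idem.
  by rewrite ef -fe.
have divides (x y : S) : (x * y * (y * x) = x * y)%sg.
  have xyE : (x * y = x * y * x * (y * x) * (y * x * y))%sg.
    rewrite -{1}(product_idem x y) -{1}(product_idem x y) -{1}(product_idem x y).
    by rewrite !smulA.
  rewrite {1}xyE -smulA (idem_comm (y * x * y)%sg) ?product_idem // smulA.
  by rewrite -(smulA _ (y * x)%sg (y * x)%sg) product_idem -xyE.
move=> x y; rewrite -[LHS]divides -[RHS]divides.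
by apply: idem_comm; apply: product_idem.
Qed.

(** * First-order definability *)

Section Definability.
Variables (d : Order.disp_t) (L : latticeType d).

(** Definability is closed under the connectives, the quantifiers and changes of
    variables. So a relation is shown to be definable for all choices of its
    variables among those of an environment; formulas are then never renamed. *)
Definition dfn n (P : ('I_n -> L) -> Prop) : Prop :=
  exists phi : formula n, forall e, holds phi e <-> P e.

Lemma dfn_iff n (P Q : ('I_n -> L) -> Prop) :
  (forall e, P e <-> Q e) -> dfn P -> dfn Q.
Proof. by move=> PQ [phi phiP]; exists phi => e; rewrite phiP. Qed.

Lemma dfn_eq n (i j : 'I_n) : dfn (fun e => e i = e j).
Proof. by exists (FEq (TVar i) (TVar j)). Qed.

Lemma dfn_le n (i j : 'I_n) : dfn (fun e => e i <= e j)%O.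
Proof.
exists (FEq (TMeet (TVar i) (TVar j)) (TVar i)) => e /=.
by rewrite leEmeet; split=> [->|/eqP].
Qed.

Lemma dfn_eq_join n (i j k : 'I_n) : dfn (fun e => e i = e j `|` e k)%O.
Proof. by exists (FEq (TVar i) (TJoin (TVar j) (TVar k))). Qed.

Lemma dfn_not n (P : ('I_n -> L) -> Prop) : dfn P -> dfn (fun e => ~ P e).
Proof. by move=> [phi phiP]; exists (FNot phi) => e /=; rewrite phiP. Qed.

Lemma dfn_and n (P Q : ('I_n -> L) -> Prop) :
  dfn P -> dfn Q -> dfn (fun e => P e /\ Q e).
Proof.
by move=> [phi phiP] [psi psiQ]; exists (FAnd phi psi) => e /=; rewrite phiP psiQ.
Qed.

Lemma dfn_or n (P Q : ('I_n -> L) -> Prop) :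
  dfn P -> dfn Q -> dfn (fun e => P e \/ Q e).
Proof.
by move=> [phi phiP] [psi psiQ]; exists (FOr phi psi) => e /=; rewrite phiP psiQ.
Qed.

Lemma dfn_imp n (P Q : ('I_n -> L) -> Prop) :
  dfn P -> dfn Q -> dfn (fun e => P e -> Q e).
Proof.
by move=> [phi phiP] [psi psiQ]; exists (FImp phi psi) => e /=; rewrite phiP psiQ.
Qed.

Lemma dfn_and3 n (P Q R : ('I_n -> L) -> Prop) :
  dfn P -> dfn Q -> dfn R -> dfn (fun e => [/\ P e, Q e & R e]).
Proof.
move=> dP dQ dR; apply: dfn_iff (dfn_and dP (dfn_and dQ dR)) => e.
by split=> [[? []]|[]].
Qed.

Lemma dfn_or3 n (P Q R : ('I_n -> L) -> Prop) :
  dfn P -> dfn Q -> dfn R -> dfn (fun e => [\/ P e, Q e | R e]).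
Proof.
move=> dP dQ dR; apply: dfn_iff (dfn_or dP (dfn_or dQ dR)) => e.
split=> [[|[]]|[]] H;
  by [constructor 1|constructor 2|constructor 3|left|right; left|right; right].
Qed.

Lemma dfn_all n (P : L -> ('I_n -> L) -> Prop) :
  dfn (fun e => P (e ord0) (fun i => e (lift ord0 i))) ->
  dfn (fun e => forall a, P a e).
Proof.
move=> [phi phiP]; exists (FAll phi) => e /=.
have eE a : (fun i => env_cons a e (lift ord0 i)) = e.
  by apply/funext => i; rewrite /env_cons liftK.
by split=> H a; have := H a; rewrite phiP eE /env_cons unlift_none.
Qed.

Lemma dfn_ex n (P : L -> ('I_n -> L) -> Prop) :
  dfn (fun e => P (e ord0) (fun i => e (lift ord0 i))) ->
  dfn (fun e => exists a, P a e).
Proof.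
move=> [phi phiP]; exists (FEx phi) => e /=.
have eE a : (fun i => env_cons a e (lift ord0 i)) = e.
  by apply/funext => i; rewrite /env_cons liftK.
by split=> -[a H]; exists a; move: H; rewrite phiP eE /env_cons unlift_none.
Qed.

Lemma dfn_ex2 n (P Q : L -> ('I_n -> L) -> Prop) :
  dfn (fun e => P (e ord0) (fun i => e (lift ord0 i))) ->
  dfn (fun e => Q (e ord0) (fun i => e (lift ord0 i))) ->
  dfn (fun e => exists2 a, P a e & Q a e).
Proof.
move=> dP dQ.
apply: dfn_iff (dfn_ex (P := fun a e => P a e /\ Q a e) _); last exact: dfn_and.
by move=> e; split=> [[a []]|[a]]; exists a.
Qed.

Lemma dfn_bounded n (P : nat -> ('I_n -> L) -> Prop) k :
  (forall j, dfn (P j)) -> dfn (fun e => forall j, (j < k)%N -> P j e).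
Proof.
move=> dP; elim: k => [|k IH].
  have [phi _] := dP 0; by exists (FImp phi phi) => e /=; split.
apply: dfn_iff (dfn_and IH (dP k)) => e; split=> [[H Hk] j|H].
  by rewrite ltnS leq_eqVlt => /predU1P[->|/H].
by split=> [j jk|]; apply: H; rewrite // ltnW.
Qed.

Definition definable_element (c : L) : Prop :=
  forall n (i : 'I_n), dfn (fun e => e i = c).

Lemma dfn_const c n (P : L -> ('I_n -> L) -> Prop) : definable_element c ->
  dfn (fun e => P (e ord0) (fun i => e (lift ord0 i))) -> dfn (fun e => P c e).
Proof.
move=> dc dP; apply: dfn_iff (dfn_ex2 (P := fun a e => a = c) (dc _ _) dP) => e.
by split=> [[a ->]|]; last exists c.
Qed.

Lemma dfn_const_le c n (i : 'I_n) : definable_element c -> dfn (fun e => c <= e i)%O.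
Proof.
by move=> dc; apply: (@dfn_const c n (fun a e => a <= e i)%O dc); apply: dfn_le.
Qed.

Lemma dfn_le_const c n (i : 'I_n) : definable_element c -> dfn (fun e => e i <= c)%O.
Proof.
by move=> dc; apply: (@dfn_const c n (fun a e => e i <= a)%O dc); apply: dfn_le.
Qed.

Lemma dfn_definable (A : set L) : dfn (fun e : 'I_1 -> L => A (e ord0)) -> definable A.
Proof. by move=> [phi phiA]; exists phi => a; apply: phiA. Qed.

End Definability.

(** * The formulas *)

(** The tactic [leaf] is tried first, lest the relations that it deals with be
    unfolded. *)
Ltac definable_by leaf := repeat first
  [ progress cbv beta | leaf
  | apply: dfn_and | apply: dfn_and3 | apply: dfn_or | apply: dfn_or3
  | apply: dfn_not | apply: dfn_all | apply: dfn_ex2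
  | apply: dfn_ex | apply: dfn_le | apply: dfn_eq | apply: dfn_eq_join
  | apply: dfn_imp ].

Ltac definable := definable_by fail.

Lemma definable_Csq1 : definable_element (Csq 1).
Proof.
move=> n i; apply: (@dfn_iff _ _ _ (fun e => forall U, e i <= U)%O).
  move=> e; split=> [H|-> U]; last exact: Csq1_le.
  by apply: le_anti; rewrite H Csq1_le.
by definable.
Qed.

Lemma dfn_only n (i j : 'I_n) : dfn (fun e => only (e i) (e j)).
Proof. by rewrite /only; definable_by ltac:(exact: definable_Csq1). Qed.

Lemma dfn_atom n (i : 'I_n) : dfn (fun e => atom (e i)).
Proof.
rewrite /atom.
by definable_by ltac:(first [exact: definable_Csq1 | exact: dfn_only]).
Qed.

Lemma definable_COM : definable_element COM.
Proof.
have dfn_almost n (i : 'I_n) : dfn (fun e => almost_all_atoms (e i)).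
  by rewrite /almost_all_atoms; definable_by ltac:(exact: dfn_atom).
move=> n i; apply: (@dfn_iff _ _ _ (fun e => almost_all_atoms (e i) /\
    forall V, almost_all_atoms V -> (e i <= V)%O)).
  move=> e; split=> [[ea emin]|->].
    by apply: le_anti; rewrite COM_least // emin //; apply: COM_almost_all_atoms.
  by split; [exact: COM_almost_all_atoms|exact: COM_least].
by definable_by ltac:(exact: dfn_almost).
Qed.

Lemma dfn_splits_off n (i j : 'I_n) : dfn (fun e => splits_off (e i) (e j)).
Proof.
pose Q n (i j : 'I_n) (e : 'I_n -> SEM) :=
  (atom (e i) /\ atom (e j)) /\ ((e i <= COM)%O /\ (e j <= COM)%O /\ e i <> e j) /\
  forall V : SEM, (V <= COM)%O -> ~ (e i <= V)%O -> (e j <= V)%O ->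
    exists U : SEM, ~ (e j <= U)%O /\ V = (U `|` e j)%O.
apply: (@dfn_iff _ _ _ (Q n i j)).
  by move=> e; split=> [[[? ?] [[? [? ?]] ?]]|[[? ? ? ? ?] ?]].
rewrite /Q; definable_by ltac:(first
  [exact: dfn_atom | exact: dfn_le_const definable_COM]).
Qed.

Lemma definable_Csq2 : definable_element (Csq 2).
Proof.
move=> n i; apply: (@dfn_iff _ _ _ (fun e => exists B, splits_off (e i) B)).
  by move=> e; split=> [[B /splits_offE[]]|->]; last by exists SL; apply/splits_offE.
by definable_by ltac:(exact: dfn_splits_off).
Qed.

Lemma definable_SL : definable_element SL.
Proof.
move=> n i; apply: (@dfn_iff _ _ _ (fun e => exists A, splits_off A (e i))).
  move=> e; split=> [[B /splits_offE[]]//|->].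
  by exists (Csq 2); apply/splits_offE.
by definable_by ltac:(exact: dfn_splits_off).
Qed.

Lemma dfn_comm_nil n (i : 'I_n) : dfn (fun e => comm_nil (e i)).
Proof.
apply: dfn_and; first exact: dfn_le_const definable_COM.
apply: (@dfn_const _ _ _ n (fun a e => only a (e i)) definable_Csq2).
exact: dfn_only.
Qed.

Lemma dfn_lt n (i j : 'I_n) : dfn (fun e : 'I_n -> SEM => e i < e j)%O.
Proof. by apply: dfn_iff (fun e => iff_sym (SEM_ltP (e i) (e j))) _; definable. Qed.

Lemma dfn_tall_chain n (i : 'I_n) : dfn (fun e => tall_chain (e i)).
Proof.
have Csq2_lt m (j : 'I_m) : dfn (fun e => Csq 2 < e j)%O.
  by apply: (@dfn_const _ _ _ m (fun a e => a < e j)%O definable_Csq2); apply: dfn_lt.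
rewrite /tall_chain /sub_chain; definable_by ltac:(first
  [exact: dfn_comm_nil | exact: Csq2_lt | exact: dfn_lt]).
Qed.

Lemma definable_Csq_oo : definable_element Csq_oo.
Proof.
move=> n i; apply: dfn_iff (fun e => Csq_oo_unique (e i)) _.
by definable_by ltac:(exact: dfn_tall_chain).
Qed.

Lemma definable_Csq k : definable_element (Csq k.+1).
Proof.
elim: k => [|k IH]; first exact: definable_Csq1.
move=> n i; apply: dfn_iff (fun e => iff_sym (Csq_succ (e i) (ltn0Sn k))) _.
by definable_by ltac:(first
  [exact: dfn_le_const definable_Csq_oo | exact: dfn_le_const IH]).
Qed.

Lemma dfn_noncommutative_witness n (i : 'I_n) :
  dfn (fun e => noncommutative_witness (e i)).
Proof.
rewrite /noncommutative_witness; definable_by ltac:(first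
  [ exact: dfn_const_le (definable_Csq 2) | exact: dfn_le_const definable_COM
  | exact: definable_Csq1 | exact: dfn_const_le definable_Csq2
  | exact: dfn_const_le definable_SL ]).
Qed.

(** By [witnessP], such a variety contains neither [P3] nor its dual. *)
Definition no_one_sided_identity (V : SEM) : Prop :=
  ~ exists2 W : SEM, (W <= V)%O & noncommutative_witness W.

Lemma dfn_no_one_sided_identity n (i : 'I_n) :
  dfn (fun e => no_one_sided_identity (e i)).
Proof.
by definable_by ltac:(exact: dfn_noncommutative_witness).
Qed.

Lemma dfn_all_powers_cr k n (i : 'I_n) : (0 < k)%N ->
  dfn (fun e => all_powers_cr k (e i)).
Proof.
move=> k0; apply: (@dfn_iff _ _ _ (fun e =>
    no_one_sided_identity (e i) /\ ~ (Csq k.+1 <= e i)%O)).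
  move=> e; rewrite all_powers_crE // /no_one_sided_identity witnessP.
  split=> [[nP nC]|[nP nQ nC]].
    by split=> // H; apply: nP; [left|right].
  by split=> // -[].
apply: dfn_and; first exact: dfn_no_one_sided_identity.
exact/dfn_not/dfn_const_le/definable_Csq.
Qed.

Theorem theorem3p5 :
  definable [set V : SEM | has_cr_power V] /\
  (forall k : nat, (0 < k)%N -> definable [set V : SEM | has_cr_kth_power k V]).
Proof.
split=> [|k k0]; apply: dfn_definable => /=.
  apply: (@dfn_iff _ _ _ (fun e =>
      no_one_sided_identity (e ord0) /\ ~ (Csq_oo <= e ord0)%O)).
    move=> e; rewrite has_cr_powerE /no_one_sided_identity witnessP.
    split=> [[nP nC]|[nP nQ nC]].
      by split=> // H; apply: nP; [left|right].
    by split=> // -[].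
  apply: dfn_and; first exact: dfn_no_one_sided_identity.
  exact/dfn_not/dfn_const_le/definable_Csq_oo.
(* Shifting the indices takes care of the positivity of the exponents. *)
apply: (@dfn_iff _ _ _ (fun e => all_powers_cr k (e ord0) /\
    forall j, (j < k.-1)%N -> ~ all_powers_cr j.+1 (e ord0))).
  move=> e; split=> [] [Vk Vmin]; split=> // j jk.
    rewrite leqNgt => jV; apply/negP => jk'; apply: (Vmin j.-1).
      by case: j jk jV jk' => // j _ _; rewrite -{1}(prednK k0).
    by rewrite prednK.
  by move=> /(Vmin _ (ltn0Sn j)); rewrite leqNgt -(prednK k0) ltnS jk.
apply: dfn_and; first exact: dfn_all_powers_cr.
by apply: dfn_bounded => j; apply/dfn_not/dfn_all_powers_cr.
Qed.
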